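(* Let $X$ be a complete Abelian topological group. (A) The following three conditions are equivalent: (1) $X$ has compact exponent; (2) for any injective continuous homomorphism $f:X\to Y$ to a topological group $Y$ and every point $y\in\overline{f(X)}\subset Y$ there exists $k\in\mathbb N$ such that $y^k\in f(X)$; (3) for any continuous homomorphism $f:X\to Y$ to a powertopological semigroup $Y$ and every point $y\in\overline{f(X)}\subset Y$ there exists $k\in\mathbb N$ such that $y^k\in f(X)$. (B) For every number $n\in\mathbb N$ the following three conditions are equivalent: (1') $n$ is a compact exponent of $X$; (2') for any injective continuous homomorphism $f:X\to Y$ to a topological group $Y$ and every point $y\in\overline{f(X)}\subset Y$ we have $y^n\in f(X)$; (3') for any continuous homomorphism $f:X\to Y$ to a powertopological semigroup $Y$ and every point $y\in\overline{f(X)}\subset Y$ we have $y^n\in f(X)$.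
   Context: All topological groups are assumed to be Hausdorff. $\mathbb N$ is the set of positive integers. $\overline{A}$ denotes the closure of $A$ in the ambient space. A topological group is complete if it is complete in its two-sided uniformity. For $n\in\mathbb N$ put $nX=\{x^n:x\in X\}$. A topological group $X$ has compact exponent if for some $n\in\mathbb N$ the set $nX$ has compact closure in $X$; any such $n$ is called a compact exponent of $X$. A powertopological semigroup is a semigroup $S$ endowed with a Hausdorff topology such that for any $a,b\in S$ and $n\in\mathbb N$ the map $S\to S$, $x\mapsto ax^nb$, is continuous. *)

(* Defs.v *)
From HB Require Import structures.
From mathcomp Require Import all_boot.
From mathcomp Require Import monoid.
From mathcomp Require Import all_classical topology.

Set Implicit Arguments.
Unset Strict Implicit.
Unset Printing Implicit Defensive.

Local Open Scope classical_set_scope.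
Local Open Scope group_scope.

HB.structure Definition PreTopologicalSemigroup :=
  {S of Topological S & Semigroup S}.

HB.structure Definition PreTopologicalGroup := {G of Topological G & Group G}.

(* All topological groups are Hausdorff by convention. *)
HB.mixin Record PreTopologicalGroup_isTopologicalGroup G
    & PreTopologicalGroup G := {
  mulg_continuous : continuous (fun z : G * G => z.1 * z.2) ;
  invg_continuous : continuous (fun x : G => x^-1) ;
  group_hausdorff : hausdorff_space G
}.

#[short(type="topologicalGroupType")]
HB.structure Definition TopologicalGroup :=
  {G of PreTopologicalGroup G & PreTopologicalGroup_isTopologicalGroup G}.

(* The n-th power in a semigroup, for n > 0; the value x at n = 0 is junk. *)
Definition sgexp (S : semigroupType) (x : S) (n : nat) : S :=
  iterop n *%g x x.

HB.mixin Record PreTopologicalSemigroup_isPowertopological S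
    & PreTopologicalSemigroup S := {
  sgexp_continuous : forall (a b : S) (n : nat), (0 < n)%N ->
    continuous (fun x : S => a * sgexp x n * b) ;
  semigroup_hausdorff : hausdorff_space S
}.

#[short(type="powertopologicalSemigroupType")]
HB.structure Definition PowertopologicalSemigroup :=
  {S of PreTopologicalSemigroup S
      & PreTopologicalSemigroup_isPowertopological S}.

(* The carrier of G endowed with its two-sided uniformity, the join of the left
   and right uniformities. *)
Definition two_sided (G : topologicalGroupType) : Type := G.

HB.instance Definition _ (G : topologicalGroupType) :=
  Topological.on (two_sided G).

Section TwoSidedUniformity.
Variable G : topologicalGroupType.

Definition two_sided_entourage : set_system (G * G) :=
  filter_from (nbhs (1 : G))
    (fun U => [set xy | U (xy.1^-1 * xy.2) /\ U (xy.2 * xy.1^-1)]).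

Let T := two_sided G.

Let two_sided_entourage_filter : Filter two_sided_entourage.
Proof.
apply: filter_from_filter; first by exists setT; exact: filterT.
move=> U V U1 V1; exists (U `&` V); first exact: filterI.
by move=> [x y] /= [[? ?] [? ?]].
Qed.

Let two_sided_entourage_diagonal (A : set (T * T)) :
  two_sided_entourage A -> diagonal `<=` A.
Proof.
move=> [U U1 UA] [x y] /= xy; apply: UA => /=.
move: xy; rewrite /diagonal /= => ->; rewrite mulVg mulgV.
by split; exact: nbhs_singleton.
Qed.

Let nbhs1V (U : set G) : nbhs (1 : G) U -> nbhs (1 : G) [set x | U x^-1].
Proof. by move=> U1; apply: invg_continuous; rewrite invg1. Qed.

Let nbhs1M (U : set G) : nbhs (1 : G) U ->
  exists2 V, nbhs (1 : G) V & forall x y, V x -> V y -> U (x * y).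
Proof.
move=> U1.
have : nbhs ((1, 1) : G * G) [set z | U (z.1 * z.2)].
  by apply: mulg_continuous; rewrite mulg1.
move=> [[V W] /= [V1 W1] VWU]; exists (V `&` W); first exact: filterI.
by move=> x y [Vx _] [_ Wy]; exact: (VWU (x, y)).
Qed.

Let two_sided_entourage_inv (A : set (T * T)) :
  two_sided_entourage A -> two_sided_entourage A^-1%relation.
Proof.
move=> [U U1 UA]; exists [set x | U x^-1]; first exact: nbhs1V.
move=> [x y] /= []; rewrite !invgM !invgK => ? ?.
by apply: UA; split.
Qed.

Let two_sided_entourage_split (A : set (T * T)) : two_sided_entourage A ->
  exists2 B, two_sided_entourage B & (B \; B `<=` A)%relation.
Proof.
move=> [U /nbhs1M[V V1 VU] UA].
exists [set xy | V (xy.1^-1 * xy.2) /\ V (xy.2 * xy.1^-1)]; first by exists V.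
move=> [x y] /= [z /= [xz zx] [zy yz]]; apply: UA => /=; split.
  by have := VU _ _ xz zy; rewrite -mulgA mulVKg.
by have := VU _ _ yz zx; rewrite mulgA mulgVK.
Qed.

Let mulgl_continuous (a : G) : continuous (fun y : G => a * y).
Proof.
move=> y; apply: (@cvg_comp _ _ _ (fun y => (a, y)) (fun z : G * G => z.1 * z.2)
  _ (nbhs ((a, y) : G * G))); last exact: (mulg_continuous (a, y)).
by apply: cvg_pair; [exact: cvg_cst|exact: cvg_id].
Qed.

Let mulgr_continuous (a : G) : continuous (fun y : G => y * a).
Proof.
move=> y; apply: (@cvg_comp _ _ _ (fun y => (y, a)) (fun z : G * G => z.1 * z.2)
  _ (nbhs ((y, a) : G * G))); last exact: (mulg_continuous (y, a)).
by apply: cvg_pair; [exact: cvg_id|exact: cvg_cst].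
Qed.

Let two_sided_nbhsE : @nbhs T T = nbhs_ two_sided_entourage.
Proof.
apply/funext => x; apply/seteqP; split => A.
  move=> Ax.
  have U1 : nbhs (1 : G) [set y | A (x * y)].
    by apply: mulgl_continuous; rewrite mulg1.
  exists [set xy | A (x * (xy.1^-1 * xy.2)) /\ A (x * (xy.2 * xy.1^-1))].
    by exists [set y | A (x * y)].
  by move=> y /xsectionP /= []; rewrite mulVKg.
move=> [B [U U1 UB] BA].
have : nbhs (x : G) ([set y | U (x^-1 * y)] `&` [set y | U (y * x^-1)]).
  apply: filterI.
    by apply: mulgl_continuous; rewrite mulVg.
  by apply: mulgr_continuous; rewrite mulgV.
by apply: filterS => y [Uy1 Uy2]; apply/BA/xsectionP/UB.
Qed.

HB.instance Definition _ := Nbhs_isUniform.Build (two_sided G)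
  two_sided_entourage_filter two_sided_entourage_diagonal
  two_sided_entourage_inv two_sided_entourage_split two_sided_nbhsE.

End TwoSidedUniformity.

Definition complete_group (G : topologicalGroupType) : Prop :=
  forall F : set_system (two_sided G),
    ProperFilter F -> cauchy F -> exists x : two_sided G, F --> x.

Definition compact_exponent (G : topologicalGroupType) (n : nat) : Prop :=
  (0 < n)%N /\ compact (closure (range (fun x : G => x ^+ n))).

Definition has_compact_exponent (G : topologicalGroupType) : Prop :=
  exists n : nat, compact_exponent G n.

(* Main.v *)
Require Import Defs.
From HB Require Import structures.
From mathcomp Require Import all_boot all_order all_algebra generic_quotient.
From mathcomp Require Import monoid.
From mathcomp Require Import all_classical reals topology normedtype.
From mathcomp Require Import Rstruct ring lra zify.

(** If [n] is a compact exponent and [f : X -> Y] is given, then [f 1] is an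
    idempotent that acts as an identity on the closure of [f X]. Hence the
    [n]-th power map is continuous on this closure, and it sends the closure
    into the compact, hence closed, image of the closure of [nX]. This
    argument covers topological groups, which are powertopological semigroups.

    For the converse, one injective continuous homomorphism [f : X -> Y] and
    one point [y] of the closure of [f X] are constructed such that every
    positive [n] with [y ^+ n] in [f X] is a compact exponent of [X]
    ([ex_noncomplete_extension]). Both equivalences follow at once.

    Write [X] additively. Choose a sequence [x] in [X] and a free ultrafilter
    [p] on the indices, and give [X * int] the finest group topology for which
    [X] maps continuously and [x i] tends to [(0, 1)] along [p]. The group [Y]
    is its Hausdorff quotient and [y] is the class of [(0, 1)]. It must be
    shown that an element [(z, m)] of the closure of [0] has [z = 0] when
    [m = 0], and that [mX] is precompact in all cases: if [y ^+ n] lies in [f X],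
    then the closure of [0] has an element with [m = - n], and as [X] is
    complete, the closure of [nX] is compact.

    The tool is a chain of neighbourhoods of zero [U 0], [U 1], ... with
    [U j.+1 + U j.+1] inside [U j]. It is good for [d] when [dX] is covered by
    finitely many translates of every [U j], while [rX] is covered by finitely
    many translates of [U 0] only if [d] divides [r]. Every neighbourhood of
    zero contains the first set of a good chain ([ex_good_chain]). This is
    where the difficulty lies: if a multiple [nX] is covered by finitely many
    translates of [U], this need not be so for smaller neighbourhoods. A
    theorem of Bogolyubov and Folner ([syndetic_chain]) repairs this: if
    finitely many translates of a symmetric set [A] cover an abelian group,
    then [A + A + A + A] contains the first member of a chain of sets with the
    same covering property. It is proved with an invariant mean, by the
    argument that Massicot and Wagner use for approximate subgroups.

    Since [d] ranges over the natural numbers, one good chain [V d] can be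
    fixed for each [d] that occurs, and the sequence [x] can be chosen generic
    for these countably many chains ([ex_generic_sequence]): for [r] not
    divisible by [d], the multiple [r x_l] stays away modulo [V d] from all
    small combinations of the earlier terms. Such a choice exists because, if
    finitely many translates of finitely many sets cover a group, then
    finitely many translates of the difference set of one of them already do
    ([cover_difference]).

    Now let [(z, m)] lie in the closure of [0], and let [U] be a good chain
    for [d]. Up to an error in [U] and [V d], the element [(z, m)] is a
    combination of the elements [(x_i, - 1)] with coefficients [a i], and
    these can be chosen with support beyond any given index. Comparing two
    such expansions and looking at the last coefficient that [d] does not
    divide, genericity shows that there is none ([coef_dvd]). Thus [d] divides
    [m], and [mX], being inside [dX], is covered by finitely many translates
    of [U 0]. If [m = 0], the expansion is a combination of the multiples
    [d x_i] with coefficients of sum zero. These multiples are Cauchy along [p]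
    for the chain [U], because [dX] is precompact for it, so [z] lies in
    [U 0]. Since every neighbourhood contains such a set [U 0], this gives both
    claims. *)

Set Implicit Arguments.
Unset Strict Implicit.
Unset Printing Implicit Defensive.

Import Order.TTheory GRing.Theory Num.Theory numFieldNormedType.Exports.

Local Open Scope classical_set_scope.
Local Open Scope ring_scope.

(** * Invariant means on abelian groups *)

Section InvariantMean.
Variables (R : realType) (G : zmodType).
Implicit Types (f h : G -> R) (g x : G) (A B : set G) (s : seq G).

Definition translate g A : set G := [set x | A (x - g)].

Record invariant_mean (mu : set G -> R) : Prop := InvariantMean {
  meanT : mu setT = 1 ;
  mean_ge0 : forall A, 0 <= mu A ;
  meanU : forall A B, A `&` B = set0 -> mu (A `|` B) = mu A + mu B ;
  mean_translate : forall g A, mu (translate g A) = mu A }.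

Definition average n g f x : R := n.+1%:R^-1 * \sum_(i < n.+1) f (x + g *+ i).

Definition averages n s f : G -> R := foldr (average n) f s.

Lemma averageD n g f h x :
  average n g (fun y => f y + h y) x = average n g f x + average n g h x.
Proof. by rewrite /average big_split mulrDr. Qed.

Lemma eq_average n g f h : f =1 h -> average n g f =1 average n g h.
Proof. by move=> fh x; rewrite /average; under eq_bigr do rewrite fh. Qed.

Lemma average_itv n g f : (forall x, 0 <= f x <= 1) ->
  forall x, 0 <= average n g f x <= 1.
Proof.
move=> f01 x; rewrite /average mulr_ge0 ?invr_ge0 ?sumr_ge0//=; last first.
  by move=> i _; case/andP: (f01 (x + g *+ i)).
rewrite mulrC ler_pdivrMr ?ltr0n// mul1r.
rewrite [leRHS](_ : _ = \sum_(i < n.+1) 1); last by rewrite sumr_const card_ord.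
by apply: ler_sum => i _; case/andP: (f01 (x + g *+ i)).
Qed.

Lemma averagesD n s f h x :
  averages n s (fun y => f y + h y) x = averages n s f x + averages n s h x.
Proof.
elim: s x => //= g s IH x; rewrite -averageD.
by apply: eq_average => y; exact: IH.
Qed.

Lemma averages_itv n s f : (forall x, 0 <= f x <= 1) ->
  forall x, 0 <= averages n s f x <= 1.
Proof. by move=> f01; elim: s => //= g s IH x; exact: average_itv. Qed.

Lemma eq_averages n s f h : f =1 h -> averages n s f =1 averages n s h.
Proof. by move=> fh; elim: s => //= g s IH; exact: eq_average. Qed.

Lemma averages_cst n s x : averages n s (fun=> 1) x = 1.
Proof.
elim: s x => //= g s IH x; rewrite (eq_average _ _ IH) /average.
by rewrite sumr_const card_ord mulVf// pnatr_eq0.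
Qed.

(** Shifting the base point by the direction of the average telescopes: all but
    two of the terms cancel. *)
Lemma average_shift n g f x : (forall x, 0 <= f x <= 1) ->
  `|average n g f (x + g) - average n g f x| <= n.+1%:R^-1.
Proof.
move=> f01; rewrite /average -mulrBr normrM ger0_norm ?invr_ge0//.
rewrite ler_piMr ?invr_ge0//.
rewrite big_ord_recr/= [X in _ - X]big_ord_recl/= mulr0n addr0.
have -> : \sum_(i < n) f (x + g + g *+ i) =
    \sum_(i < n) f (x + g *+ bump 0 i).
  by apply: eq_bigr => i _; rewrite -addrA -mulrS.
have /andP[a0 a1] := f01 x; have /andP[b0 b1] := f01 (x + g + g *+ n).
by rewrite ler_norml; apply/andP; split; lra.
Qed.

Lemma averages_shift n s g f x : g \in s -> (forall x, 0 <= f x <= 1) ->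
  `|averages n s f (x + g) - averages n s f x| <= n.+1%:R^-1.
Proof.
move=> + f01; elim: s x => //= g0 s IH x; rewrite inE => /orP[/eqP ->|gs].
  exact/average_shift/averages_itv.
rewrite /average -mulrBr -sumrB normrM ger0_norm ?invr_ge0//.
rewrite mulrC ler_pdivrMr ?ltr0n//.
have -> : n.+1%:R^-1 * n.+1%:R = \sum_(i < n.+1) n.+1%:R^-1 :> R.
  by rewrite sumr_const card_ord mulr_natr.
rewrite (le_trans (ler_norm_sum _ _ _))//; apply: ler_sum => i _.
by rewrite addrAC; exact: IH.
Qed.

Lemma ultra_cvg_itv T (F : set_system T) (f : T -> R) : UltraFilter F ->
  (forall i, 0 <= f i <= 1) -> exists l : R, f @ F --> l.
Proof.
move=> FU f01; have F01 : (f @ F) `[0, 1]%classic.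
  by apply: (@filterS _ F _ setT) filterT => i _ /=; rewrite in_itv/= f01.
have FF : ProperFilter (f @ F) by exact: fmap_proper_filter.
have [l [_ lF]] := segment_compact FF F01.
exists l => B lB; have [//|nB] := in_ultra_setVsetC (f @^-1` B) FU.
by have [y [nBy By]] := lF (~` B) B nB lB.
Qed.

Let far (i : seq G * nat) : set (seq G * nat) :=
  [set j : seq G * nat | {subset i.1 <= j.1} /\ (i.2 <= j.2)%N].

Let boxes : set_system (seq G * nat) := filter_from setT far.

Let boxes_proper : ProperFilter boxes.
Proof.
apply: filter_from_proper; last by move=> i _; exists i; split.
apply: filter_from_filter; first by exists ([::], 0%N).
move=> [s m] [t n] _ _; exists (s ++ t, maxn m n) => //= -[u k] /= [su mk].
by split; split=> /=; rewrite ?(leq_trans _ mk) ?leq_maxl ?leq_maxr//;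
  move=> x xs; apply: su; rewrite mem_cat xs ?orbT.
Qed.

Let ind A : G -> R := fun x => (`[< A x >])%:R.

Let ind01 A x : 0 <= ind A x <= 1.
Proof. by rewrite /ind; case: asboolP => _; rewrite ?lexx ?ler01. Qed.

Let density A (i : seq G * nat) : R := averages i.2 i.1 (ind A) 0.

(** Averaging the indicator of a set over ever larger boxes is ever less
    sensitive to translations; an ultrafilter turns these averages into one
    limit. *)
Lemma ex_invariant_mean : exists mu, invariant_mean mu.
Proof.
have [p [pU boxp]] := ultraFilterLemma boxes_proper.
have density01 A i : 0 <= density A i <= 1 by apply: averages_itv; exact: ind01.
have /choice[mu muP] A : exists l : R, density A @ p --> l.
  exact: ultra_cvg_itv.
have lim_unique (f : seq G * nat -> R) (l l' : R) :
    f @ p --> l -> f @ p --> l' -> l = l'.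
  have FF : ProperFilter (f @ p) by exact: fmap_proper_filter.
  exact: (@cvg_unique R (@norm_hausdorff _ R) (f @ p) FF l l').
exists mu; split.
- apply: (lim_unique (density setT)) (muP _) _.
  have -> : density setT = fun=> 1; last exact: cvg_cst.
  apply/funext => -[s n]; rewrite -[RHS](averages_cst n s 0).
  by apply: eq_averages => x; rewrite /ind asboolT.
- move=> A; apply: (cvgr_to_ge (muP A)); apply: nearW => i.
  by case/andP: (density01 A i).
- move=> A B AB0; apply: (lim_unique (density (A `|` B))) (muP _) _.
  have -> : density (A `|` B) = density A + density B.
    apply/funext => -[s n]; rewrite [RHS](esym (averagesD _ _ _ _ _)).
    apply: eq_averages => x.
    rewrite /ind; case: asboolP => [[Ax|Bx]|nAB].
    + rewrite (asboolT Ax) asboolF ?addr0// => Bx.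
      by have : (A `&` B) x by []; rewrite AB0.
    + rewrite (asboolT Bx) asboolF ?add0r// => Ax.
      by have : (A `&` B) x by []; rewrite AB0.
    + by rewrite !asboolF ?addr0// => ?; apply: nAB; [right|left].
  exact: cvgD.
- move=> g A; suff : mu A - mu (translate g A) = 0 by move/subr0_eq.
  apply: (lim_unique (density A - density (translate g A))).
    exact: cvgB.
  apply/cvgr0Pnorm_le => e e0.
  pose n := Num.truncn e^-1.
  apply: filterS (boxp (far ([:: g], n)) _); last by exists ([:: g], n).
  move=> [s k] [/= gs nk].
  change (`|density A (s, k) - density (translate g A) (s, k)| <= e).
  have -> : density (translate g A) (s, k) =
      averages k s (ind A) (0 - g).
    rewrite /density /=; elim: s {gs} 0 => [|h s IH] x /=.
      by rewrite /ind /translate.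
    rewrite /average; congr (_ * _); apply: eq_bigr => i _.
    by rewrite IH addrAC.
  rewrite /density/= -[X in averages _ _ _ X - _](subrK g).
  rewrite (le_trans (averages_shift _ _ _ _))//.
    by apply: gs; rewrite inE.
  rewrite invf_ple ?posrE//.
  by rewrite (le_trans (ltW (truncnS_gt _)))// ler_nat ltnS.
Qed.

End InvariantMean.

(** * Syndetic sets and the Bogolyubov-Folner theorem *)

Section Bogolyubov.
Variable G : zmodType.
Implicit Types (A B C S U : set G) (E : seq G) (g x : G).

Definition sumset A B : set G := [set a + b | a in A & b in B].

Definition doubling A : set G := sumset A A.

Definition symmetric_set A := forall x, A x -> A (- x).

Definition syndetic S :=
  exists E : seq G, forall x, exists2 e, e \in E & S (x - e).

(** A neighbourhood base of zero for a pseudometrizable group topology. *)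
Definition chain (U : nat -> set G) := [/\ forall j, U j 0,
  forall j, symmetric_set (U j) &
  forall j x y, U j.+1 x -> U j.+1 y -> U j (x + y)].

Section Mean.
Variables (R : realType) (mu : set G -> R).
Hypothesis mean_mu : invariant_mean mu.

Let splitD A B : mu A = mu (A `&` B) + mu (A `\` B).
Proof.
rewrite -(meanU mean_mu) ?setUIDK//.
by rewrite setDE setIACA setICr setI0.
Qed.

Lemma le_mean A B : A `<=` B -> mu A <= mu B.
Proof.
move=> AB; rewrite (splitD B A) setIidr// lerDl; exact: mean_ge0 mean_mu _.
Qed.

Lemma mean_le1 A : mu A <= 1.
Proof. by rewrite -(meanT mean_mu); exact: le_mean. Qed.

Lemma meanUI A B : mu (A `|` B) + mu (A `&` B) = mu A + mu B.
Proof.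
rewrite (splitD (A `|` B) A) setUK setDUl setDv set0U (splitD B A).
by rewrite -addrA addrC [B `&` A]setIC (addrC (mu (B `\` A))) addrC.
Qed.

Let mean0 : mu set0 = 0.
Proof.
have := meanU mean_mu (setI0 set0); rewrite setU0 => /eqP.
by rewrite -subr_eq0 opprD addNKr oppr_eq0 => /eqP.
Qed.

Lemma mean_nonempty A : 0 < mu A -> A !=set0.
Proof.
by move=> A0; apply/set0P; apply: contraTneq A0 => ->; rewrite mean0 ltxx.
Qed.

Lemma mean_cover_le (P : G -> set G) (r : R) E :
  (forall e, e \in E -> mu (P e) <= r) ->
  mu [set x | exists2 e, e \in E & P e x] <= r *+ size E.
Proof.
elim: E => [_|e E IH Pr].
  by rewrite (_ : [set x | _] = set0) ?mean0// -subset0 => x [].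
rewrite /= mulrS (_ : [set x | _] =
    P e `|` [set x | exists2 e, e \in E & P e x]); last first.
  apply/seteqP; split=> [x [e']|x [Px|[e' e'E Px]]].
  - by rewrite inE => /orP[/eqP->|e'E] Px; [left|right; exists e'].
  - by exists e; rewrite ?inE ?eqxx.
  - by exists e'; rewrite ?inE ?e'E ?orbT.
rewrite (le_trans (y := mu (P e) +
    mu [set x | exists2 e, e \in E & P e x]))//.
  by rewrite -meanUI lerDl; exact: mean_ge0 mean_mu _.
apply: lerD; first by apply: Pr; rewrite inE eqxx.
by apply: IH => e' e'E; apply: Pr; rewrite inE e'E orbT.
Qed.

Lemma mean_syndetic A : syndetic A -> 0 < mu A.
Proof.
move=> [E AE]; rewrite lt0r (mean_ge0 mean_mu) andbT; apply/eqP => A0.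
have /mean_cover_le : forall e, e \in E -> mu (translate e A) <= 0.
  by move=> e _; rewrite (mean_translate mean_mu) A0.
rewrite mul0rn (_ : [set x | _] = setT); last first.
  by apply/seteqP; split=> x // _; exact: AE.
by rewrite (meanT mean_mu) ler10.
Qed.

(** If finitely many translates of the set of these returns did not cover the
    group, arbitrarily many pairwise almost disjoint translates of [B] could be
    chosen one after the other, which the total mass forbids. *)
Lemma syndetic_returns B : 0 < mu B ->
  exists2 s : R, 0 < s & syndetic [set g | s <= mu (translate g B `&` B)].
Proof.
move=> B0; pose b := mu B; pose n := (Num.truncn (2 / b)).+1.
have nb : 2 < n%:R * b by rewrite -ltr_pdivrMr// truncnS_gt.
have n0 : 0 < n%:R :> R by rewrite ltr0n.
(* With overlaps below [b / 2n], the union of [n] translates of [B] has mass at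
   least [n b - n ^ 2 b / 2n = n b / 2 > 1]. *)
exists (b / (2 * n%:R)); first by rewrite divr_gt0// mulr_gt0.
set s := b / _; apply: contrapT => nsynd.
have far E : exists x, forall e, e \in E -> mu (translate (x - e) B `&` B) < s.
  apply: contrapT => nx; apply: nsynd; exists E => x.
  apply: contrapT => ne; apply: nx; exists x => e eE.
  by rewrite ltNge; apply/negP => sle; apply: ne; exists e.
pose cover E := [set x | exists2 e, e \in E & B (x - e)].
have ex_cover k : exists E, size E = k /\
    k%:R * b - k%:R ^+ 2 * s <= mu (cover E).
  have s0 : 0 < s by rewrite divr_gt0// mulr_gt0.
  elim: k => [|k [E [sE lE]]].
    exists [::]; split=> //.
    by rewrite mul0r expr0n mul0r subrr (mean_ge0 mean_mu).
  have [x xfar] := far E.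
  exists (x :: E); split; first by rewrite /= sE.
  have -> : cover (x :: E) = translate x B `|` cover E.
    apply/seteqP; split=> [y [e]|y [By|[e eE Be]]].
    - by rewrite inE => /orP[/eqP->|eE] By; [left|right; exists e].
    - by exists x; rewrite ?inE ?eqxx.
    - by exists e; rewrite ?inE ?eE ?orbT.
  have : mu (translate x B `&` cover E) <= s *+ k.
    rewrite -sE; apply: le_trans (mean_cover_le (P := fun e =>
      translate x B `&` translate e B) _).
      by apply: le_mean => y [By [e eE Be]]; exists e.
    move=> e eE; apply: ltW; apply: le_lt_trans (xfar e eE).
    rewrite -(mean_translate mean_mu (- e)) /translate; apply: le_mean => y /=.
    rewrite !opprK addrK => -[By ?]; split=> //.
    by rewrite (_ : y - (x - e) = y + e - x) // opprB addrA.
  have := meanUI (translate x B) (cover E).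
  rewrite (mean_translate mean_mu) -/b -mulr_natr -[k.+1%:R]natr1.
  have : 0 <= k%:R :> R by [].
  nra.
have [E [_]] := ex_cover n.
have -> : n%:R ^+ 2 * s = n%:R * b / 2 by rewrite /s; field; rewrite gt_eqF.
have := mean_le1 (cover E); lra.
Qed.

Lemma mean_sumset A B : B !=set0 -> mu A <= mu (sumset B A).
Proof.
move=> [b Bb]; rewrite -(mean_translate mean_mu b); apply: le_mean => x Ax.
by exists b => //; exists (x - b) => //; rewrite addrC subrK.
Qed.

(** As long as the conclusion fails, [B] can be replaced by its intersection
    with one of its translates so that the mass of [B + A] drops by [mu A / 8].
    This stops, because the mass of [B + A] never goes below that of [A]. *)
Lemma ex_stable_subset A : 0 < mu A -> exists B (s : R),
  [/\ B `<=` A, B !=set0, syndetic [set g | s <= mu (translate g B `&` B)] &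
      forall g, s <= mu (translate g B `&` B) ->
        mu (sumset B A) - mu A / 8 < mu (sumset (translate g B `&` B) A)].
Proof.
move=> A0; have ex n : forall B, B `<=` A -> 0 < mu B ->
    mu (sumset B A) <= mu A + n%:R * (mu A / 8) -> exists B' (s : R),
  [/\ B' `<=` A, B' !=set0, syndetic [set g | s <= mu (translate g B' `&` B')] &
      forall g, s <= mu (translate g B' `&` B') ->
        mu (sumset B' A) - mu A / 8 < mu (sumset (translate g B' `&` B') A)].
  elim: n => [|n IH] B BA B0 Bn; have [s s0 synds] := syndetic_returns B0.
    exists B, s; split=> // [|g sg]; first exact: mean_nonempty.
    apply: lt_le_trans (mean_sumset _ _); last first.
      by apply: mean_nonempty; exact: lt_le_trans sg.
    by move: Bn; lra.
  have [gB|/existsNP[g /not_implyP[sg /negP]]] := pselect (forall g,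
      s <= mu (translate g B `&` B) ->
      mu (sumset B A) - mu A / 8 < mu (sumset (translate g B `&` B) A)).
    by exists B, s; split=> //; exact: mean_nonempty.
  rewrite -leNgt => gB; apply: (IH (translate g B `&` B)).
  - by move=> x [_ /BA].
  - exact: lt_le_trans sg.
  - by move: gB Bn; rewrite -natr1; lra.
pose n := (Num.truncn (8 / mu A)).+1.
have nA : 8 < n%:R * mu A by rewrite -ltr_pdivrMr// truncnS_gt.
apply: (ex n A) => //.
have := mean_le1 (sumset A A); lra.
Qed.

Let defectD C g h : mu (translate (g + h) C `\` C) <=
  mu (translate g C `\` C) + mu (translate h C `\` C).
Proof.
rewrite -(mean_translate mean_mu g (translate h C `\` C)) -meanUI.
rewrite -[leLHS]addr0 lerD ?(mean_ge0 mean_mu)//; apply: le_mean => x [Cx nCx].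
have [Cxg|nCxg] := pselect (C (x - g)); first by left.
by right; split=> //; rewrite /translate/= -addrA -opprD.
Qed.

(** For [B] as in the previous lemma, translating [C = B + A] by a return [g]
    of [B] moves it by less than [mu A / 8]. So the translate of [C] by a sum
    of eight returns still meets [C], and this sum is a difference of two
    elements of [C], hence a sum of four elements of [A]. *)
Lemma double_syndetic A : symmetric_set A -> syndetic A ->
  exists2 S, symmetric_set S /\ syndetic S &
    iter 3 doubling S `<=` iter 2 doubling A.
Proof.
move=> symA /mean_syndetic A0.
have [B [s [BA [b Bb] synds stable]]] := ex_stable_subset A0.
pose C := sumset B A; pose S := [set g | s <= mu (translate g B `&` B)].
have AC : mu A <= mu C by apply: mean_sumset; exists b.
have translateI (D : set G) g : translate (- g) (translate g D `&` D) =
    translate (- g) D `&` D.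
  by apply/seteqP; split=> x; rewrite /translate/= opprK addrK => -[].
have symS : symmetric_set S.
  by move=> g; rewrite /S/= -translateI (mean_translate mean_mu).
have small n g : iter n doubling S g ->
    mu (translate g C `\` C) < 2 ^+ n * (mu A / 8).
  elim: n g => [g Sg|n IH _ [g /IH gn [h /IH hn <-]]]; last first.
    rewrite exprS -mulrA mulr2n mulrDl !mul1r.
    exact: le_lt_trans (defectD _ _ _) (ltrD gn hn).
  rewrite expr0 mul1r.
  have := splitD (translate g C) C; rewrite (mean_translate mean_mu) -/C.
  suff : mu (sumset (translate g B `&` B) A) <= mu (translate g C `&` C).
    by have := stable g Sg; rewrite -/C; lra.
  apply: le_mean => _ [x [Bxg Bx] [a Aa <-]]; split.
    by exists (x - g) => //; exists a => //; rewrite addrAC.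
  by exists x => //; exists a.
exists S => //; move=> g /small; rewrite (_ : 2 ^+ 3 = 8); last by ring.
rewrite mulrC divfK ?pnatr_eq0// => gA.
have [x [[b1 Bb1 [a1 Aa1 xE1]] [b2 Bb2 [a2 Aa2 xE2]]]] :
    translate g C `&` C !=set0.
  apply: mean_nonempty; have := splitD (translate g C) C.
  by rewrite (mean_translate mean_mu); have := AC; lra.
exists (b2 + - b1).
  by exists b2; [exact: BA|exists (- b1); [exact/symA/BA|]].
exists (a2 + - a1).
  by exists a2 => //; exists (- a1); [exact/symA|].
by rewrite addrACA -opprD xE2 xE1 opprB addrC subrK.
Qed.

End Mean.

(** The Bogolyubov-Folner theorem in a form without characters: the sets [B j]
    form a neighbourhood base of zero for a precompact group topology. They are
    the fourfold sums of the sets obtained by iterating [double_syndetic]. *)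
Theorem syndetic_chain A : symmetric_set A -> syndetic A ->
  exists B : nat -> set G, [/\ chain B, forall j, syndetic (B j) &
    B 0%N `<=` iter 2 doubling A].
Proof.
move=> symA syndA; have [mu mean_mu] := ex_invariant_mean Rdefinitions.R G.
pose P (A : set G) := symmetric_set A /\ syndetic A.
have /choice[next nextP] (D : set G) : exists S : set G, P D ->
    P S /\ iter 3 doubling S `<=` iter 2 doubling D.
  have [[symD syndD]|nPD] := pselect (P D); last by exists D.
  by have [S PS SD] := double_syndetic mean_mu symD syndD; exists S.
pose S j := iter j next A.
have PS j : P (S j) by elim: j => // j /nextP[].
have sym_double D : symmetric_set D -> symmetric_set (doubling D).
  move=> symD _ [x Dx [y Dy <-]]; exists (- x); first exact: symD.
  by exists (- y); [exact: symD|rewrite opprD].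
have double_sub0 D : symmetric_set D -> D !=set0 -> doubling D 0.
  move=> symD [x Dx]; exists x => //.
  by exists (- x); [exact: symD|exact: subrr].
have synd_nonempty D : syndetic D -> D !=set0.
  by move=> [E /(_ 0)[e _ De]]; exists (0 - e).
have synd_double D : syndetic D -> syndetic (doubling D).
  move=> syndD; have [d Dd] := synd_nonempty _ syndD; have [E DE] := syndD.
  exists [seq e - d | e <- E] => x; have [e eE De] := DE x.
  exists (e - d); first exact: map_f.
  by exists (x - e) => //; exists d => //; rewrite opprB addrA addrAC.
exists (fun j => iter 2 doubling (S j)); split=> //.
  split=> j; have [symS syndS] := PS j.
  - apply: (double_sub0 (doubling (S j))); first exact/sym_double.
    exact/synd_nonempty/synd_double.
  - exact/sym_double/sym_double.
  - move=> x y Sx Sy; have [_] := nextP _ (PS j); apply.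
    by exists x => //; exists y.
by move=> j; have [_ syndS] := PS j; exact/synd_double/synd_double.
Qed.

End Bogolyubov.

(** * Precompact multiples and good chains *)

Section GoodChains.
Variable G : zmodType.
Implicit Types (A B C S : set G) (E : seq G) (x : G) (U V : nat -> set G).

Definition mul_bounded (r : int) A :=
  exists E : seq G, forall x, exists2 e, e \in E & A (x *~ r - e).

Lemma mul_boundedS r A B : A `<=` B -> mul_bounded r A -> mul_bounded r B.
Proof.
by move=> AB [E EA]; exists E => x; have [e eE /AB] := EA x; exists e.
Qed.

Lemma mul_boundedD r s A B C : (forall x y, A x -> B y -> C (x + y)) ->
  mul_bounded r A -> mul_bounded s B -> mul_bounded (r + s) C.
Proof.
move=> ABC [E EA] [F FB]; exists [seq e + f | e <- E, f <- F] => x.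
have [e eE Ae] := EA x; have [f fF Bf] := FB x.
exists (e + f); first exact: allpairs_f.
by rewrite mulrzDr opprD addrACA; exact: ABC.
Qed.

Lemma mul_boundedM r k A : mul_bounded r A -> mul_bounded (k * r) A.
Proof.
move=> [E EA]; exists E => x; have [e eE Ae] := EA (x *~ k).
by exists e => //; rewrite mulrzA.
Qed.

Lemma chain_le U i j : chain U -> (i <= j)%N -> U j `<=` U i.
Proof.
move=> [U0 _ UD]; elim: j => [|j IH]; first by rewrite leqn0 => /eqP ->.
rewrite leq_eqVlt => /orP[/eqP -> //|ij] x Ux; apply: IH => //.
by rewrite -[x]addr0; exact: UD.
Qed.

Lemma chain_shift U k : chain U -> chain (fun j => U (k + j)%N).
Proof.
move=> [U0 US UD]; split=> // j x y Ux Uy.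
by apply: UD; rewrite -addnS.
Qed.

Lemma chainI U V : chain U -> chain V -> chain (fun j => U j `&` V j).
Proof.
move=> [U0 US UD] [V0 VS VD]; split=> [j|j x [Ux Vx]|j x y [Ux Vx] [Uy Vy]].
- by split.
- by split; [exact: US|exact: VS].
- by split; [exact: UD|exact: VD].
Qed.

Lemma chainB U j x y : chain U -> U j.+1 x -> U j.+1 y -> U j (x - y).
Proof. by move=> [_ US UD] Ux Uy; apply: UD => //; exact: US. Qed.

(** The axioms of the filter of neighbourhoods of zero of a group topology on
    an abelian group, not necessarily Hausdorff. *)
Record zero_nbhs (N : set_system G) : Prop := ZeroNbhs {
  zero_nbhs_filter : Filter N ;
  zero_nbhs0 : forall A, N A -> A 0 ;
  zero_nbhs_half : forall A, N A -> exists B,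
    [/\ N B, symmetric_set B & forall x y, B x -> B y -> A (x + y)] }.

Variable N : set_system G.
Hypothesis zN : zero_nbhs N.

Definition nbhs_chain U := chain U /\ forall j, N (U j).

Lemma ex_nbhs_chain A : N A -> exists2 U, nbhs_chain U & U 0%N `<=` A.
Proof.
move=> NA; have /choice[half halfP] (C : set G) : exists B, N C ->
    [/\ N B, symmetric_set B & forall x y, B x -> B y -> C (x + y)].
  have [/(zero_nbhs_half zN)[B BP]|nN] := pselect (N C); last by exists C.
  by exists B.
have NU j : N (iter j half A) by elim: j => // j /halfP[].
exists (fun j => iter j.+1 half A); last first.
  move=> x Ux; have [NB _ BA] := halfP _ NA; rewrite -[x]addr0; apply: BA => //.
  exact: (zero_nbhs0 zN).
split=> [|j]; last exact: NU.
split=> [j|j|j x y]; first exact: (zero_nbhs0 zN (NU j.+1)).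
- by have [] := halfP _ (NU j).
- by have [_ _] := halfP _ (NU j.+1); apply.
Qed.

(** The multipliers [r] such that [r G] is precompact for the whole chain form
    an ideal of the integers, but a single set of the chain may fail to tell
    them from the others. In a good chain the largest set already does, and
    [d] generates the ideal. For [d = 0] no positive multiple of [G] is
    precompact. *)
Definition good_chain U (d : nat) := [/\ nbhs_chain U,
  forall j, mul_bounded d (U j) &
  forall r : int, ~~ (d%:Z %| r)%Z -> ~ mul_bounded r (U 0%N)].

Lemma mul_bounded0 A : A 0 -> mul_bounded 0 A.
Proof.
by move=> A0; exists [:: 0] => x; exists 0; rewrite ?inE// mulr0z subrr.
Qed.

(** The generator [d] of the ideal of multipliers is positive, so it suffices
    that one set of the chain excludes the finitely many remainders modulo [d];
    the other multipliers are reduced to these by division, at the cost of one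
    further step along the chain. *)
Lemma good_chain_shift U n : nbhs_chain U -> (0 < n)%N ->
  (forall j, mul_bounded n (U j)) ->
  exists J d, good_chain (fun j => U (J + j)%N) d.
Proof.
move=> [cU NU] n0 nU.
have exd : exists d : nat, (0 < d)%N && `[< forall j, mul_bounded d (U j) >].
  by exists n; rewrite n0; exact/asboolP.
case: (ex_minnP exd) => d /andP[d0 /asboolP dU] d_min.
have /choice[lev levP] (s : nat) : exists j, (0 < s < d)%N ->
    ~ mul_bounded s (U j).
  have [/andP[s0 sd]|] := boolP (0 < s < d)%N; last by exists 0%N.
  apply: contrapT => ns; have : (d <= s)%N.
    apply: d_min; rewrite s0; apply/asboolP => j; apply: contrapT => nb.
    by apply: ns; exists j.
  by rewrite leqNgt sd.
pose J := \max_(s < d) lev s.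
exists J.+1, d; split=> [|j|r nr]; first by split=> [|j //]; exact: chain_shift.
  exact: dU.
rewrite addn0 => rU.
pose s := `|(r %% d%:Z)%Z|%N.
have sE : s%:Z = (r %% d%:Z)%Z by rewrite gez0_abs// modz_ge0// -lt0n.
have sd : (s < d)%N by rewrite -ltz_nat sE ltz_pmod.
have s0 : (0 < s)%N.
  by rewrite lt0n -eqz_nat sE; apply: contra nr => /eqP/dvdz_mod0P.
apply: (levP s); first by rewrite s0.
apply: (@mul_boundedS _ (U J)).
  by apply: chain_le => //; exact: (leq_bigmax (Ordinal sd)).
have -> : s%:Z = r + - (r %/ d%:Z)%Z * d%:Z.
  by rewrite sE {2}(divz_eq r d) mulNr [X in X - _]addrC addrK.
apply: mul_boundedD rU (mul_boundedM _ (dU J.+1)).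
by case: cU => _ _; apply.
Qed.

(** If no positive multiple of [G] is bounded modulo some neighbourhood, any
    smaller chain is good for [0]. Otherwise some [n G] is bounded modulo a
    small [V 5], and the elements [x] with [n x] in [V 4] form a syndetic set.
    The Bogolyubov-Folner chain [B] inside the fourfold sum of this set makes
    [n G] precompact for the chain of neighbourhoods [V (3 + j) + n B j]. *)
Theorem ex_good_chain A : N A ->
  exists U d, good_chain U d /\ U 0%N `<=` A.
Proof.
have NF := zero_nbhs_filter zN.
move=> NA; have [[B NB nB]|allB] := pselect (exists2 B, N B &
    forall n : nat, (0 < n)%N -> ~ mul_bounded n B).
  have [U [cU NU] UAB] := ex_nbhs_chain (filterI NA NB).
  exists U, 0%N; split; last by move=> x /UAB[].
  split=> // [j|r r0 rU].
    by apply: mul_bounded0; case: cU.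
  rewrite dvd0z in r0; apply: (nB `|r|%N); first by rewrite absz_gt0.
  rewrite abszEsg; apply: mul_boundedM; apply: mul_boundedS rU.
  by move=> x /UAB[].
have [V [cV NV] VA] := ex_nbhs_chain NA; have [V0 VS VD] := cV.
have [n n0 [E EV]] : exists2 n : nat, (0 < n)%N & mul_bounded n (V 5%N).
  apply: contrapT => nV; apply: allB; exists (V 5%N) => // n n0 nVn.
  by apply: nV; exists n.
pose S := [set x : G | V 4%N (x *~ n)].
have symS : symmetric_set S by move=> x; rewrite /S/= mulNrz; exact: VS.
have syndS : syndetic S.
  have /choice[f fP] e : exists y, (exists x, V 5%N (x *~ n - e)) ->
      V 5%N (y *~ n - e).
    by have [[x Vx]|nx] := pselect (exists x, V 5%N (x *~ n - e));
      [exists x|exists 0].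
  exists (map f E) => x; have [e eE Ve] := EV x.
  exists (f e); first exact: map_f.
  rewrite /S/=; have -> : (x - f e) *~ n = (x *~ n - e) - (f e *~ n - e).
    by rewrite mulrzBl opprB addrA subrK.
  by apply: chainB => //; apply: fP; exists x.
have [B [[B0 BS BD] syndB B4]] := syndetic_chain symS syndS.
pose U j := sumset (V (3 + j)%N) [set b *~ n | b in B j].
have cU : nbhs_chain U.
  split=> [|j]; last first.
    apply: filterS (NV (3 + j)%N) => x Vx; exists x => //; exists 0.
      by exists 0; [exact: B0|rewrite mul0rz].
    by rewrite addr0.
  split=> j.
  - exists 0; first exact: V0.
    by exists 0; rewrite ?addr0//; exists 0; rewrite ?mul0rz.
  - move=> _ [v Vv [_ [b Bb <-] <-]]; exists (- v); first exact: VS.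
    exists (- b *~ n); last by rewrite opprD mulNrz.
    by exists (- b); first exact: BS.
  - move=> _ _ [v Vv [_ [b Bb <-] <-]] [w Vw [_ [c Bc <-] <-]].
    exists (v + w); first by apply: VD; rewrite -addnS.
    exists ((b + c) *~ n); first by exists (b + c); first exact: BD.
    by rewrite mulrzDl addrACA.
have nU j : mul_bounded n (U j).
  have [F FB] := syndB j; exists [seq f *~ n | f <- F] => x.
  have [f fF Bf] := FB x; exists (f *~ n); first exact: map_f.
  exists 0; first exact: V0.
  by exists ((x - f) *~ n); [exists (x - f)|rewrite add0r mulrzBl].
have [J [d gd]] := good_chain_shift cU n0 nU.
exists (fun j => U (J + j)%N), d; split=> //.
rewrite addn0; apply: (subset_trans (chain_le cU.1 (leq0n J))).
move=> _ [v Vv [_ [b /B4 fourb <-] <-]].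
have [s [s1 S1 [s2 S2 <-]] [t [t1 T1 [t2 T2 <-]] <-]] := fourb.
apply/VA/VD; first by apply: chain_le Vv.
rewrite !mulrzDl; apply: (chain_le cV (isT : (1 <= 2)%N)).
by apply: (VD 2%N); apply: (VD 3%N).
Qed.

End GoodChains.

(** * Generic sequences *)

Section GenericSequence.
Variable G : zmodType.
Implicit Types (E F : seq G).

(** An analogue of the lemma of B. H. Neumann on coverings by cosets. If the
    difference set of [A i] is not syndetic, some translate of the union of
    the given translates of [A i] is disjoint from this union, so it is
    covered by translates of the other sets, and [A i] can be dropped from the
    covering. *)
Lemma cover_difference (I : eqType) (s : seq I) (A : I -> set G) E :
  (forall x, exists2 e, e \in E & exists2 i, i \in s & A i (x - e)) ->
  exists2 i, i \in s & syndetic [set u - v | u in A i & v in A i].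
Proof.
elim: s E => [E /(_ 0)[e _ []]//|i s IH E EA].
have [synd|nsynd] := pselect (syndetic [set u - v | u in A i & v in A i]).
  by exists i => //; rewrite mem_head.
have [g gP] : exists g, forall e e', e \in E -> e' \in E ->
    ~ [set u - v | u in A i & v in A i] (g - (e' - e)).
  apply: contrapT => ng; apply: nsynd; exists [seq e' - e | e' <- E, e <- E].
  move=> x; apply: contrapT => nx; apply: ng; exists x => e e' eE e'E xA.
  by apply: nx; exists (e' - e) => //; exact: (allpairs_f (fun e' e => e' - e)).
have [x|j js synd] := IH (E ++ [seq e - g | e <- E]); last first.
  by exists j => //; rewrite inE js orbT.
have [e eE [j]] := EA x; rewrite inE => /orP[/eqP->{j}|js] Ax; last first.
  by exists e; [rewrite mem_cat eE|exists j].
have [e' e'E [j]] := EA (x + g); rewrite inE => /orP[/eqP->{j}|js] Ax'.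
  case: (gP _ _ eE e'E); exists (x + g - e') => //; exists (x - e) => //.
  rewrite opprB opprB [x + g]addrC -2!addrA [x + _]addrC -addrA subrK.
  by rewrite [- e' + e]addrC.
exists (e' - g); first by rewrite mem_cat (map_f (fun e => e - g)) ?orbT.
by exists j => //; rewrite opprB addrA.
Qed.

Definition int_ball (B : nat) : seq int :=
  [seq k%:Z | k <- iota 0 B.+1] ++ [seq - k%:Z | k <- iota 0 B.+1].

Arguments int_ball : simpl never.

Lemma mem_int_ball (B : nat) (a : int) : (`|a|%N <= B)%N -> a \in int_ball B.
Proof.
move=> aB; rewrite /int_ball mem_cat; apply/orP; case: a aB => a aB.
  by left; apply: (map_f Posz); rewrite mem_iota add0n ltnS.
by right; rewrite NegzE; apply: (map_f (fun k => - k%:Z)); rewrite mem_iota.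
Qed.

Lemma ex_combinations (x : nat -> G) (B n : nat) :
  exists F, forall c : nat -> int, (forall i, (i < n)%N -> (`|c i|%N <= B)%N) ->
    \sum_(i < n) x i *~ c i \in F.
Proof.
elim: n => [|n [F FP]].
  by exists [:: 0] => c _; rewrite big_ord0 mem_head.
exists [seq f + x n *~ a | f <- F, a <- int_ball B] => c cB.
rewrite big_ord_recr.
apply/allpairsP; exists (\sum_(i < n) x i *~ c i, c n); split=> //=.
  by apply: FP => i /ltnW/cB.
exact/mem_int_ball/cB.
Qed.

Lemma ex_dependent_sequence (P : nat -> (nat -> G) -> G -> Prop) :
  (forall n x x' z, (forall i, (i < n)%N -> x i = x' i) ->
    P n x z -> P n x' z) ->
  (forall n x, exists z, P n x z) -> exists x : nat -> G, forall n, P n x (x n).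
Proof.
move=> Pext exP; have /choice[next nextP] (y : nat * (nat -> G)) :
    exists z, P y.1 y.2 z by exact: exP.
pose fix stage n : nat -> G := if n is m.+1 then
  fun i => if (i < m)%N then stage m i else next (m, stage m) else fun=> 0.
have stageE n m i : (i < n)%N -> (n <= m)%N -> stage m i = stage n i.
  move=> ni; elim: m => [|m IH].
    by rewrite leqn0 => /eqP n0; rewrite n0 in ni.
  rewrite leq_eqVlt => /orP[/eqP->//|nm]; rewrite [LHS]/= (leq_trans ni)//.
  exact: IH.
exists (fun n => stage n.+1 n) => n /=; rewrite ltnn.
apply: Pext (nextP (n, stage n)) => i ni.
by rewrite -[RHS]/(stage i.+1 i); exact: stageE.
Qed.

Variables (N : set_system G) (V : nat -> nat -> set G) (D : set nat).
Variable E : nat -> seq G.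
Hypothesis goodV : forall d, D d -> good_chain N (V d) d.

(** If every [z] failed for one of the finitely many pairs [(d, r)], finitely
    many translates of the sets of [z] with [r z] in [V d 1] would cover the
    group. By [cover_difference] one of these sets would have a syndetic
    difference set, and [r G] would be bounded modulo [V d 0]. *)
Lemma ex_avoiding (s : seq (nat * int)) F :
  (forall i, i \in s -> D i.1 /\ ~~ (i.1%:Z %| i.2)%Z) ->
  exists z, forall d r f, (d, r) \in s -> f \in F -> ~ V d 2 (z *~ r - f).
Proof.
move=> sD; apply: contrapT => nz.
have cover z : exists2 i, i \in s & exists2 f, f \in F & V i.1 2 (z *~ i.2 - f).
  apply: contrapT => nc; apply: nz; exists z => d r f ds fF Vz.
  by apply: nc; exists (d, r) => //; exists f.
have /choice[w wP] (i : (nat * int) * G) : exists w,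
    (exists z, V i.1.1 2 (z *~ i.1.2 - i.2)) -> V i.1.1 2 (w *~ i.1.2 - i.2).
  have [[z Vz]|nVz] := pselect (exists z, V i.1.1 2 (z *~ i.1.2 - i.2)).
    by exists z.
  by exists 0.
have [z|[d r] /[dup] /sD[/= Dd nr] drs [H HP]] :=
    @cover_difference _ s (fun i => [set z | V i.1 1 (z *~ i.2)])
    [seq w (i, f) | i <- s, f <- F].
  have [i si [f fF Vz]] := cover z; exists (w (i, f)).
    exact: (allpairs_f (fun i f => w (i, f))).
  exists i => //=; have [Di _] := sD _ si; have [[cV _] _ _] := goodV Di.
  have -> : (z - w (i, f)) *~ i.2 = z *~ i.2 - f - (w (i, f) *~ i.2 - f).
    by rewrite mulrzBl opprB addrA subrK.
  by apply: chainB => //; apply: (wP (i, f)); exists z.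
have [[cV _] _ /(_ _ nr)] := goodV Dd; apply.
exists [seq h *~ r | h <- H] => z; have [h hH [u Vu [v Vv uv]]] := HP z.
exists (h *~ r); first exact: map_f.
by rewrite -mulrzBl -uv mulrzBl; apply: chainB.
Qed.

(** At stage [l] only finitely many [d], [r], [c] and [e] are constrained, so
    [ex_avoiding] provides the next term. The sets [E d] will be finite nets of
    [d G], so that a multiple [r x_l] is also kept away from sums of an earlier
    combination and a multiple of [d]. *)
Lemma ex_generic_sequence : exists x : nat -> G,
  forall l d (r : int) (c : nat -> int) e, D d -> (d <= l)%N ->
    (`|r|%N <= 2 ^ l)%N -> ~~ (d%:Z %| r)%Z ->
    (forall i, (i < l)%N -> (`|c i|%N <= 2 ^ l.+1)%N) -> e \in E d ->
    ~ V d 2 (x l *~ r - (\sum_(i < l) x i *~ c i + e)).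
Proof.
apply: (ex_dependent_sequence (P := fun l x z => forall d (r : int)
    (c : nat -> int) e, D d -> (d <= l)%N ->
    (`|r|%N <= 2 ^ l)%N -> ~~ (d%:Z %| r)%Z ->
    (forall i, (i < l)%N -> (`|c i|%N <= 2 ^ l.+1)%N) -> e \in E d ->
    ~ V d 2 (z *~ r - (\sum_(i < l) x i *~ c i + e)))) => [n x x' z xx'|l x].
  move=> + d r c e Dd dn rn nr cn eE => /(_ d r c e Dd dn rn nr cn eE).
  by under eq_bigr do rewrite xx'//.
have [F FP] := ex_combinations x (2 ^ l.+1) l.
pose s := [seq i <- [seq (d, r) | d <- iota 0 l.+1, r <- int_ball (2 ^ l)] |
  `[< D i.1 >] && ~~ (i.1%:Z %| i.2)%Z].
pose E' := flatten [seq E d | d <- iota 0 l.+1].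
have [i|z zP] := @ex_avoiding s [seq f + e | f <- F, e <- E'].
  by rewrite mem_filter => /andP[/andP[/asboolP]].
exists z => d r c e Dd dl rl nr cl eE; apply: zP.
  rewrite mem_filter; apply/andP; split; first by rewrite /= nr asboolT.
  apply/allpairsP; exists (d, r).
  by split=> //; [rewrite mem_iota ltnS|exact: mem_int_ball].
apply/allpairsP; exists (\sum_(i < l) x i *~ c i, e); split=> //=.
  exact: FP.
by apply/flattenP; exists (E d) => //; apply: map_f; rewrite mem_iota ltnS.
Qed.

End GenericSequence.

(** * The topology on the extension by the integers *)

Lemma ultra_seq_cover (I : eqType) T (p : set_system T) (s : seq I)
    (A : I -> set T) : UltraFilter p ->
  p [set t | exists2 i, i \in s & A i t] -> exists2 i, i \in s & p (A i).
Proof.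
move=> pU; elim: s => [p0|i s IH ps].
  by have [t [i]] := filter_ex p0.
have [pAi|pnAi] := in_ultra_setVsetC (A i) pU.
  by exists i => //; exact: mem_head.
have [|j js pAj] := IH; last by exists j => //; rewrite inE js orbT.
apply: filterS (filterI ps pnAi) => t [[j]].
by rewrite inE => /orP[/eqP -> //|js] Aj _; exists j.
Qed.

Lemma big_ord_trail (R : Type) (idx : R) (op : Monoid.law idx) (f : nat -> R)
    (M M' : nat) : (forall i, (M <= i)%N -> f i = idx) -> (M <= M')%N ->
  \big[op/idx]_(i < M') f i = \big[op/idx]_(i < M) f i.
Proof.
move=> f0 MM'; rewrite -!(big_mkord xpredT f) (big_cat_nat (n := M))//=.
have -> : \big[op/idx]_(M <= i < M') f i = idx.
  by rewrite big_nat_cond big1// => i /andP[/andP[/f0]].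
by rewrite Monoid.mulm1.
Qed.

Section ChainSums.
Variables (G : zmodType) (U : nat -> set G).
Hypothesis chainU : chain U.

Lemma chain_sum_seq j k (t : seq G) : (forall y, y \in t -> U (j + k)%N y) ->
  (size t <= 2 ^ k)%N -> U j (\sum_(y <- t) y).
Proof.
have [U0 _ UD] := chainU.
elim: k j t => [|k IH] j t tU st.
  case: t st tU => [|y [|//]] _ tU; first by rewrite big_nil.
  by rewrite big_seq1 -[j]addn0; apply: tU; exact: mem_head.
rewrite -(cat_take_drop (2 ^ k) t) big_cat; apply: UD; apply: (IH j.+1).
- by move=> y /mem_take/tU; rewrite addSnnS.
- by rewrite size_take_min geq_minl.
- by move=> y /mem_drop/tU; rewrite addSnnS.
- by rewrite size_drop leq_subLR addnn -mul2n -expnS.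
Qed.

Lemma chain_sum_mulz j k M (b : nat -> int) (h : nat -> G) :
  (forall i, (i < M)%N -> b i != 0 -> U (j + k)%N (h i)) ->
  (\sum_(i < M) `|b i| <= 2 ^ k)%N -> U j (\sum_(i < M) h i *~ b i).
Proof.
have [_ US _] := chainU; move=> hU.
suff [t [st <- tU]] : exists t, [/\ size t = (\sum_(i < M) `|b i|)%N,
    \sum_(y <- t) y = \sum_(i < M) h i *~ b i &
    forall y, y \in t -> U (j + k)%N y] by rewrite -st; exact: chain_sum_seq.
elim: M hU => [_|M IH hU]; first by exists [::]; rewrite !big_ord0 big_nil.
have [i iM|t [st tE tU]] := IH; first by apply: hU; exact: ltnW.
exists (t ++ nseq `|b M|%N (h M *~ sgz (b M))); split.
- by rewrite size_cat size_nseq st big_ord_recr.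
- rewrite big_cat/= tE [in RHS]big_ord_recr/=; congr (_ + _).
  by rewrite big_nseq iter_addr_0 pmulrn -mulrzA -intEsg.
- move=> y; rewrite mem_cat => /orP[/tU //|]; rewrite mem_nseq.
  rewrite absz_gt0 => /andP[bM0 /eqP ->]; have := hU M (ltnSn M) bM0.
  case: sgzP bM0 => // _ _; rewrite ?mulr1z// mulrN1z; exact: US.
Qed.

End ChainSums.

Section SeparatingChain.
Variable G : zmodType.
Variables (N : set_system G) (V : nat -> nat -> set G) (D : set nat).
Variables (E : nat -> seq G) (x : nat -> G) (p : set_system nat).
Hypothesis zN : zero_nbhs N.
Hypothesis goodV : forall d, D d -> good_chain N (V d) d.
Hypothesis EV : forall d, D d ->
  forall y, exists2 e, e \in E d & V d 3 (y *~ d - e).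
Hypothesis x_generic : forall l d (r : int) (c : nat -> int) e,
  D d -> (d <= l)%N -> (`|r|%N <= 2 ^ l)%N -> ~~ (d%:Z %| r)%Z ->
  (forall i, (i < l)%N -> (`|c i|%N <= 2 ^ l.+1)%N) -> e \in E d ->
  ~ V d 2 (x l *~ r - (\sum_(i < l) x i *~ c i + e)).
Hypothesis p_ultra : UltraFilter p.
Hypothesis p_free : forall k, p [set i | (k <= i)%N].

(** Neighbourhood bases of zero of pseudometrizable group topologies on
    [G * int] for which the inclusion of [G] is continuous and [x] tends to
    [(0, 1)] along [p]. *)
Definition admissible (W : nat -> set (G * int)) :=
  [/\ chain W, forall j, N [set u | W j (u, 0)] &
      forall j, p [set i | W j (x i, -1)]].

(** A precompact set is Cauchy along every ultrafilter. *)
Lemma ultra_small_differences U j d : chain U -> mul_bounded d (U j.+1) ->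
  exists F, p F /\ forall i i', F i -> F i' -> U j (x i *~ d - x i' *~ d).
Proof.
move=> cU [H HU]; have [e eH pe] : exists2 e, e \in H &
    p [set i | U j.+1 (x i *~ d - e)].
  apply: ultra_seq_cover; apply: filterS filterT => i _; exact: HU.
exists [set i | U j.+1 (x i *~ d - e)]; split=> // i i' Ui Ui'.
rewrite (_ : _ - _ = (x i *~ d - e) - (x i' *~ d - e)); last first.
  by rewrite opprB addrA subrK.
exact: chainB.
Qed.

Section OneGoodChain.
Variables (U : nat -> set G) (d : nat).
Hypotheses (Dd : D d) (goodU : good_chain N U d).

(* The shifts by 1 and by 4 leave room for the sums formed in [separatesW] and
   in [coef_dvd], which have to end in [U 0] and in [V d 2]. *)
Let T k := U k.+1 `&` V d (4 + k)%N.

Let chainU : chain U. Proof. by case: goodU => -[]. Qed.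
Let chainV : chain (V d). Proof. by have [[]] := goodV Dd. Qed.

Let chainT : chain T.
Proof.
apply: chainI; first exact: (chain_shift 1 chainU).
exact: (chain_shift 4 chainV).
Qed.

Variable F : nat -> set nat.
Hypothesis pF : forall k, p (F k).
Hypothesis smallF : forall k i i', F k i -> F k i' ->
  U (k.*2 + 3)%N (x i *~ d - x i' *~ d).

(* The indices of level at least [k]. At such indices the multiples [d x_i]
   differ by elements of [U (2 k + 3)]. *)
Let Q k i := `[< (k < i)%N /\ forall k', (k' <= k)%N -> F k' i >].

Let QS k i : Q k.+1 i -> Q k i.
Proof.
move=> /asboolP[ki Fi]; apply/asboolP; split; first exact: ltnW.
by move=> k' k'k; apply: Fi; exact: leqW.
Qed.

Let Q_le k k' i : (k <= k')%N -> Q k' i -> Q k i.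
Proof. by move=> /subnK <-; elim: (k' - k)%N => // n IH /QS. Qed.

Let Q_lt k i : Q k i -> (k < i)%N. Proof. by move=> /asboolP[]. Qed.

Let pQ k : p [set i | Q k i].
Proof.
elim: k => [|k IH].
  apply: filterS (filterI (p_free 1) (pF 0)) => i [i0 Fi]; apply/asboolP.
  by split=> // k'; rewrite leqn0 => /eqP ->.
apply: filterS (filterI (filterI (p_free k.+2) (pF k.+1)) IH).
move=> i [[ki Fi] /asboolP[_ Qi]]; apply/asboolP; split=> // k'.
by rewrite leq_eqVlt => /orP[/eqP->|/Qi].
Qed.

(* The part of the combination [a] that lives on indices of level below [k]. *)
Let weight (a : nat -> int) M k := (\sum_(i < M) ~~ Q k i * `|a i|)%N.

(* The bounds on the weights are halved when [j] increases, so they define a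
   chain, and they let a single index of level [j] occur with coefficient 1.
   They force [a] to vanish below level [j], and bound the total size of the
   coefficients at each level in terms of the level only. *)
Let R j (a : nat -> int) M (z : G * int) :=
  [/\ forall i, (M <= i)%N -> a i = 0,
      T j (z.1 - \sum_(i < M) x i *~ a i),
      z.2 = - \sum_(i < M) a i &
      forall k, (2 ^ j * weight a M k < 2 ^ k)%N].

Let R_widen j a M M' z : (M <= M')%N -> R j a M z -> R j a M' z.
Proof.
move=> MM' [a0 Tz zE wa]; split.
- by move=> i /(leq_trans MM')/a0.
- by rewrite (@big_ord_trail _ _ _ (fun i => x i *~ a i) M)// => i /a0 ->.
- by rewrite (@big_ord_trail _ _ _ a M).
- move=> k; rewrite /weight.
  rewrite (@big_ord_trail _ _ _ (fun i => ~~ Q k i * `|a i|)%N M)//.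
    exact: wa.
  by move=> i /a0 ->; rewrite muln0.
Qed.

Let W j : set (G * int) := [set z | exists a M, R j a M z].

Let chainW : chain W.
Proof.
have [T0 TS TD] := chainT; split.
- move=> j; exists (fun=> 0), 0%N.
  split=> //; rewrite ?big_ord0 ?subr0 ?oppr0//.
  by move=> k; rewrite /weight big_ord0 muln0 expn_gt0.
- move=> j [z m] [a [M [a0 Tz /= zE wa]]].
  exists (fun i => - a i), M; split=> /=.
  + by move=> i /a0 ->; rewrite oppr0.
  + under eq_bigr do rewrite mulrNz.
    by rewrite sumrN -opprD; exact: TS.
  + by rewrite sumrN zE.
  + move=> k; rewrite /weight; under eq_bigr do rewrite abszN.
    exact: wa.
- move=> j [z m] [z' m'] [a [M RM]] [a' [M' RM']].
  have {RM}[a0 /= Tz -> wa] := R_widen (leq_maxl M M') RM.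
  have {RM'}[a'0 /= Tz' -> wa'] := R_widen (leq_maxr M M') RM'.
  exists (fun i => a i + a' i), (maxn M M'); split=> /=.
  + by move=> i Mi; rewrite a0// a'0// addr0.
  + under eq_bigr do rewrite mulrzDr.
    by rewrite big_split opprD addrACA; exact: TD.
  + by rewrite big_split opprD.
  + move=> k; have le_w : (weight (fun i => (a i + a' i)%R) (maxn M M') k <=
        weight a (maxn M M') k + weight a' (maxn M M') k)%N.
      rewrite /weight -big_split leq_sum// => i _; rewrite /= -mulnDr leq_mul2l.
      by apply/orP; right; lia.
    have := wa k; have := wa' k; rewrite expnS -!mulnA.
    by have := leq_mul (leqnn (2 ^ j)) le_w; rewrite mulnDr; lia.
Qed.

Let admissibleW : admissible W.
Proof.
have NF := zero_nbhs_filter zN; have [T0 _ _] := chainT; split=> [|j|j].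
- exact: chainW.
- have [[_ NU] _ _] := goodU; have [[_ NV] _ _] := goodV Dd.
  apply: filterS (filterI (NU j.+1) (NV (4 + j)%N)) => u Tu.
  exists (fun=> 0), 0%N; split=> //; rewrite ?big_ord0 ?subr0 ?oppr0//.
  by move=> k; rewrite /weight big_ord0 muln0 expn_gt0.
- apply: filterS (pQ j) => i Qi.
  exists (fun l => (l == i)%:Z), i.+1; split=> /=.
  + by move=> l il; rewrite gtn_eqF.
  + rewrite big_ord_recr/= eqxx mulr1z big1 ?add0r ?subrr// => l _.
    by rewrite ltn_eqF.
  + by rewrite big_ord_recr/= eqxx big1 ?add0r// => l _; rewrite ltn_eqF.
  + move=> k; rewrite /weight big_ord_recr/= eqxx big1 ?add0n; last first.
      by move=> l _; rewrite ltn_eqF// muln0.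
    have [kj|jk] := leqP k j; first by rewrite (Q_le kj Qi) muln0 expn_gt0.
    apply: leq_ltn_trans (_ : 2 ^ j * 1 < _)%N; last by rewrite muln1 ltn_exp2l.
    by rewrite leq_mul2l; case: Q; rewrite orbT.
Qed.

Let coef_le j a M z k i : R j a M z -> (i < M)%N -> ~~ Q k i ->
  (2 ^ j * `|a i| < 2 ^ k)%N.
Proof.
move=> [_ _ _ /(_ k) wa] iM nQ; apply: leq_ltn_trans wa; rewrite leq_mul2l.
by rewrite /weight (bigD1 (Ordinal iM))//= nQ mul1n leq_addr orbT.
Qed.

Let coef_bound j a M z i : R j a M z -> (`|a i| < 2 ^ i)%N.
Proof.
move=> RM; have [iM|Mi] := ltnP i M; last first.
  by have [a0 _ _ _] := RM; rewrite a0// expn_gt0.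
apply: leq_ltn_trans (coef_le RM iM (_ : ~~ Q i i)).
  by rewrite leq_pmull// expn_gt0.
by apply/negP => /Q_lt; rewrite ltnn.
Qed.

Let coef_support j a M z i : R j a M z -> a i != 0 -> Q j i.
Proof.
move=> RM; apply: contraNT => nQ; have [iM|Mi] := ltnP i M; last first.
  by have [a0 _ _ _] := RM; rewrite a0.
have := coef_le RM iM nQ; rewrite -{2}[(2 ^ j)%N]muln1 ltn_pmul2l ?expn_gt0//.
by rewrite ltnS leqn0 absz_eq0.
Qed.

(** Take two expansions of [z], the second supported beyond the first, and let
    [l] be the last index at which [d] fails to divide the coefficient [r] of
    the second. Up to elements of [V d 3], the multiple [r x_l] is the
    difference of the earlier terms of the expansions and of a multiple of
    [d], which contradicts genericity. *)
Let coef_dvd z : (forall j, W j z) -> exists j a M,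
  R j a M z /\ forall l, (d%:Z %| a l)%Z.
Proof.
have [V0 VS VD] := chainV; have [T0 TS TD] := chainT.
move=> Wz; have [a [M RM]] := Wz 0%N.
pose j := maxn M d; have [a' [M' RM']] := Wz j.
exists j, a', M'; split=> //.
have [a0 Tz _ _] := RM; have [a'0 Tz' _ _] := RM'.
suff step l : (forall l', (l < l')%N -> (d%:Z %| a' l')%Z) -> (d%:Z %| a' l)%Z.
  move=> l; have [n] := ubnP (M' - l)%N; elim: n l => // n IH l ln.
  apply: step => l' ll'; have [l'M|/a'0->] := ltnP l' M'; last exact: dvdz0.
  by apply: IH; lia.
move=> dvd_after; apply: contrapT => /negP ndvd.
have a'l0 : a' l != 0 by apply: contraNneq ndvd => ->; exact: dvdz0.
have lM' : (l < M')%N by rewrite ltnNge; apply: contra a'l0 => /a'0 ->.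
have jl : (j < l)%N by exact/Q_lt/(coef_support RM').
have dl : (d <= l)%N by rewrite (leq_trans _ (ltnW jl))// /j; lia.
have Ml : (M <= l)%N by rewrite (leq_trans _ (ltnW jl))// /j; lia.
pose y := \sum_(l.+1 <= i < M') x i *~ (a' i %/ d)%Z.
have sumE : \sum_(i < M') x i *~ a' i =
    \sum_(i < l) x i *~ a' i + x l *~ a' l + y *~ d.
  rewrite -(big_mkord xpredT (fun i => x i *~ a' i)).
  rewrite (big_cat_nat (n := l.+1))//=.
  rewrite big_nat_recr//= big_mkord; congr (_ + _).
  rewrite /y mulrz_suml big_nat_cond [RHS]big_nat_cond; apply: eq_bigr => i.
  by move=> /andP[/andP[li _] _]; rewrite -mulrzA divzK// dvd_after.
have [e eE Ve] := EV Dd (- y).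
apply: (x_generic (c := fun i => a i - a' i) Dd dl _ ndvd _ eE).
- exact/ltnW/(coef_bound _ RM').
- move=> i il; have := coef_bound i RM; have := coef_bound i RM'.
  have : (2 ^ i.+1 <= 2 ^ l.+1)%N by rewrite leq_exp2l// ltnS ltnW.
  rewrite expnS; lia.
rewrite (_ : _ - _ =
    ((z.1 - \sum_(i < M) x i *~ a i) - (z.1 - \sum_(i < M') x i *~ a' i)) +
    (- y *~ d - e)); last first.
  have -> : \sum_(i < M) x i *~ a i = \sum_(i < l) x i *~ a i.
    symmetry; apply: (@big_ord_trail _ _ _ (fun i => x i *~ a i) M) => // i.
    by move=> /a0 ->.
  rewrite sumE mulNrz opprB [z.1 - _ + _]addrC subrKA.
  under eq_bigr do rewrite mulrzBr.
  rewrite sumrB [in RHS]addrAC addrA addrK opprD opprB !addrA.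
  by rewrite [x l *~ _ + _]addrC [RHS]addrAC.
apply: VD => //; apply: chainB => //; first by have [] := Tz.
by have [] := chain_le chainT (leq0n j) Tz'.
Qed.

(** If the coefficients have sum zero, the combination of the [d x_i] is
    unchanged when one of them, of very high level, is subtracted from all. The
    terms of level [k] are then in [U (2 k + 3)], and there are at most
    [2 ^ k.+1] of them with multiplicity, so they add up to an element of
    [U k.+2]. *)
Let separatesW z : (forall j, W j z) ->
  (d%:Z %| z.2)%Z /\ (z.2 = 0 -> U 0 z.1).
Proof.
move=> /coef_dvd[j [a [M [RM da]]]]; have [a0 Tz -> _] := RM.
split=> [|sum0]; first by rewrite rpredN rpred_sum.
have [U0 US UD] := chainU.
have TU : U 1 (z.1 - \sum_(i < M) x i *~ a i).
  by have [] := chain_le chainT (leq0n j) Tz.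
rewrite -(subrK (\sum_(i < M) x i *~ a i) z.1); apply: (UD 0%N) => //.
pose b i := (a i %/ d%:Z)%Z.
have ab i : a i = b i * d%:Z by rewrite /b divzK.
have leba i : (`|b i| <= `|a i|)%N by have := lez_div (a i) d; rewrite /b; lia.
have bQ i : b i != 0 -> Q 0 i.
  move=> bi0; apply: (Q_le (leq0n j)); apply: (coef_support RM).
  by apply: contraNneq bi0; rewrite /b => ->; rewrite div0z.
have [ref Qref] := filter_ex (pQ M).
pose h i := x i *~ d - x ref *~ d.
have sumE : \sum_(i < M) x i *~ a i = \sum_(i < M) h i *~ b i.
  rewrite /h; under [RHS]eq_bigr do rewrite mulrzBl -!mulrzA mulrC -ab.
  rewrite sumrB -[LHS]subr0; congr (_ - _).
  by rewrite -mulrz_sumr -[\sum_(_ < _) a _]opprK sum0 oppr0 mulr0z.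
pose mask k i : int := if Q k i then b i else 0.
(* Summing the levels from the highest down loses one step of the chain each
   time. *)
have tail n k : (k + n = M)%N -> U k.+1 (\sum_(i < M) h i *~ mask k i).
  elim: n k => [k|n IH k kM].
    rewrite addn0 => kM; rewrite big1// => -[i iM] _ /=; rewrite /mask.
    case: ifP => [/Q_lt|]; last by rewrite mulr0z.
    by rewrite kM ltnNge (ltnW iM).
  pose diff i : int := if Q k i && ~~ Q k.+1 i then b i else 0.
  have maskE i : mask k i = mask k.+1 i + diff i.
    rewrite /mask /diff; case: (boolP (Q k.+1 i)) => [/QS ->|_].
      by rewrite addr0.
    by rewrite add0r andbT.
  under eq_bigr do rewrite maskE mulrzDr.
  rewrite big_split; apply: (UD k.+1); first by apply: IH; rewrite addSnnS.
  apply: (@chain_sum_mulz _ _ chainU k.+2 k.+1) => [i iM|].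
    rewrite /diff; case: ifP => // /andP[Qi _] _.
    have -> : (k.+2 + k.+1 = k.*2 + 3)%N by lia.
    have kM' : (k <= M)%N by lia.
    apply: smallF; first by have /asboolP[_] := Qi; apply.
    by have /asboolP[_] := Q_le kM' Qref; apply.
  have [_ _ _ /(_ k.+1) wa] := RM.
  have : (weight a M k.+1 < 2 ^ k.+1)%N.
    by apply: leq_ltn_trans wa; rewrite leq_pmull// expn_gt0.
  move=> /ltnW; apply: leq_trans; apply: leq_sum => i _; rewrite /diff.
  by case: ifP => [/andP[_ ->]|_]; rewrite ?mul1n.
rewrite sumE; have := tail M 0%N (add0n M); congr (U 1%N _).
apply: eq_bigr => i _; congr (_ *~ _); rewrite /mask; case: ifPn => //.
by move=> nQ; apply/esym/eqP; apply: contraNT nQ; exact: bQ.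
Qed.

Lemma ex_separating_chain_of : exists W, admissible W /\
  forall z, (forall j, W j z) -> (d%:Z %| z.2)%Z /\ (z.2 = 0 -> U 0 z.1).
Proof. by exists W; split; [exact: admissibleW|exact: separatesW]. Qed.

End OneGoodChain.

Lemma ex_separating_chain U d : D d -> good_chain N U d -> exists W,
  admissible W /\
  forall z, (forall j, W j z) -> (d%:Z %| z.2)%Z /\ (z.2 = 0 -> U 0 z.1).
Proof.
move=> Dd goodU; have [[cU _] dU _] := goodU.
have /choice[F FP] k := ultra_small_differences cU (dU (k.*2 + 3).+1).
apply: (ex_separating_chain_of Dd goodU (F := F)) => k.
  by have [] := FP k.
by have [_] := FP k.
Qed.

Definition extension_nbhs : set_system (G * int) :=
  [set A | exists2 W, admissible W & W 0%N `<=` A].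

Lemma zero_nbhs_extension : zero_nbhs extension_nbhs.
Proof.
have NF := zero_nbhs_filter zN; split.
- split.
  + exists (fun=> setT) => //; split=> [|j|j]; first by split.
      exact: filterT.
    exact: filterT.
  + move=> A B [W [cW NW pW] WA] [W' [cW' NW' pW'] WB].
    exists (fun j => W j `&` W' j); last by move=> z [/WA ? /WB].
    split=> [|j|j]; first exact: chainI.
      exact: filterI (NW j) (NW' j).
    exact: filterI (pW j) (pW' j).
  + by move=> A B AB [W aW WA]; exists W => //; exact: subset_trans AB.
- by move=> A [W [[W0 _ _] _ _]]; apply; exact: W0.
- move=> A [W [cW NW pW] WA]; exists (W 1%N); have [W0 WS WD] := cW; split=> //.
    by exists (fun j => W (1 + j)%N) => //; split=> //; exact: chain_shift.
  by move=> y z Wy Wz; apply/WA/WD.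
Qed.

End SeparatingChain.

(** All the group topologies given by admissible chains are used at once: for
    each good chain [U] one of them separates zero from the elements outside
    [U 0], and the sequence [x] does not depend on [U]. *)
Theorem ex_extension (G : zmodType) (N : set_system G) : zero_nbhs N ->
  (forall u, (forall A, N A -> A u) -> u = 0) ->
  exists W : set_system (G * int), [/\ zero_nbhs W,
    forall A, W A -> N [set u | A (u, 0)],
    forall A, W A -> exists u, A (u, -1) &
    forall z, (forall A, W A -> A z) ->
      (z.2 = 0 -> z.1 = 0) /\ forall A, N A -> mul_bounded z.2 A].
Proof.
move=> zN sepN; pose D := [set d | exists U, good_chain N U d].
have /choice[V goodV] (d : nat) : exists U, D d -> good_chain N U d.
  have [[U goodU]|nD] := pselect (D d); first by exists U.
  by exists (fun=> setT).
have /choice[E EV] (d : nat) : exists E : seq G, D d ->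
    forall y, exists2 e, e \in E & V d 3 (y *~ d - e).
  have [/goodV[_ /(_ 3%N)[E EV] _]|nD] := pselect (D d); first by exists E.
  by exists [::].
have [x x_generic] := ex_generic_sequence E goodV.
have [p [p_ultra p_oo]] := ultraFilterLemma (eventually_filter).
have p_free k : p [set i | (k <= i)%N] by apply: p_oo; exact: nbhs_infty_ge.
have zW := zero_nbhs_extension x zN p_ultra.
exists (extension_nbhs N x p); split=> //.
- have NF := zero_nbhs_filter zN.
  by move=> A [W [_ NW _] WA]; apply: filterS (NW 0%N) => u /WA.
- move=> A [W [_ _ pW] WA]; have [i Wi] := filter_ex (pW 0%N).
  by exists (x i); exact: WA.
- move=> z Wz.
  have key A : N A -> exists U d, [/\ good_chain N U d, U 0%N `<=` A,
      (d%:Z %| z.2)%Z & z.2 = 0 -> U 0%N z.1].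
    move=> NA; have [U [d [goodU UA]]] := ex_good_chain zN NA.
    have Dd : D d by exists U.
    have [W [[cW NW pW] sepW]] :=
      ex_separating_chain zN goodV EV x_generic p_ultra p_free Dd goodU.
    have [|dz Uz] := sepW z; last by exists U, d.
    move=> j; apply: Wz; exists (fun k => W (j + k)%N); last by rewrite addn0.
    by split=> //; exact: chain_shift.
  split=> [z0|A /key[U [d [[_ dU _] UA /dvdzP[k ->] _]]]].
    by apply: sepN => A /key[U [d [_ UA _ Uz]]]; exact/UA/Uz.
  by apply: mul_boundedM; apply: mul_boundedS (dU 0%N).
Qed.

(** * The Hausdorff quotient of a group topology *)

Section HausdorffQuotient.
Variables (M : zmodType) (W : set_system M).
Hypothesis zW : zero_nbhs W.

Let H : set M := [set z | forall A, W A -> A z].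

Let H0 : H 0. Proof. by move=> A; exact: (zero_nbhs0 zW). Qed.

Let HD x y : H x -> H y -> H (x + y).
Proof.
move=> Hx Hy A WA; have [B [WB _ BA]] := zero_nbhs_half zW WA.
by apply: BA; [exact: Hx|exact: Hy].
Qed.

Let HN x : H x -> H (- x).
Proof.
move=> Hx A WA; have [B [WB symB BA]] := zero_nbhs_half zW WA.
rewrite -[- x]addr0; apply: BA; first exact: (symB x (Hx B WB)).
exact: (zero_nbhs0 zW).
Qed.

Definition same_class : rel M := fun x y => `[< H (x - y) >].

Let same_class_refl : reflexive same_class.
Proof. by move=> x; apply/asboolP; rewrite subrr; exact: H0. Qed.

Let same_class_sym : ssrbool.symmetric same_class.
Proof.
by move=> x y; apply/asboolP/asboolP => /HN; rewrite opprB.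
Qed.

Let same_class_trans : transitive same_class.
Proof.
move=> y x z /asboolP xy /asboolP yz; apply/asboolP.
by rewrite -(subrKA y); exact: HD.
Qed.

Canonical same_class_equiv :=
  EquivRel same_class same_class_refl same_class_sym same_class_trans.

Definition hausdorff_quotient : Type := {eq_quot same_class_equiv}%qT.

HB.instance Definition _ := Choice.on hausdorff_quotient.

Definition class_of (x : M) : hausdorff_quotient :=
  (\pi_({eq_quot same_class_equiv}) x)%qT.

Let class_ofP x y : class_of x = class_of y <-> H (x - y).
Proof.
split=> [/eqP|Hxy]; first by rewrite eqmodE => /asboolP.
by apply/eqP; rewrite eqmodE; apply/asboolP.
Qed.

Let rep (y : hausdorff_quotient) : M :=
  repr (y : {eq_quot same_class_equiv}%qT).

Let repK y : class_of (rep y) = y.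
Proof. exact: reprK. Qed.

Let classD x x' y y' : class_of x = class_of x' -> class_of y = class_of y' ->
  class_of (x + y) = class_of (x' + y').
Proof.
move=> /class_ofP Hx /class_ofP Hy; apply/class_ofP.
by rewrite opprD addrACA; exact: HD.
Qed.

Let qmul (y y' : hausdorff_quotient) := class_of (rep y + rep y').
Let qinv (y : hausdorff_quotient) := class_of (- rep y).

Let qmulE x x' : qmul (class_of x) (class_of x') = class_of (x + x').
Proof. by apply: classD; rewrite repK. Qed.

Let qmulA : associative qmul.
Proof.
by move=> x y z; rewrite -(repK x) -(repK y) -(repK z) !qmulE addrA.
Qed.

Let qmulC : commutative qmul.
Proof. by move=> x y; rewrite /qmul addrC. Qed.

Let qmul1 : left_id (class_of 0) qmul.
Proof. by move=> x; rewrite -(repK x) qmulE add0r. Qed.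

Let qmulV : left_inverse (class_of 0) qinv qmul.
Proof. by move=> x; rewrite -{2}(repK x) qmulE addNr. Qed.

HB.instance Definition _ := isGroup.Build hausdorff_quotient
  qmulA qmul1 (fun x => etrans (qmulC _ _) (qmul1 x))
  qmulV (fun x => etrans (qmulC _ _) (qmulV x)).

Lemma class_ofD x y : class_of (x + y) = (class_of x * class_of y)%g.
Proof. by symmetry; exact: qmulE. Qed.

Definition quotient_nbhs (y : hausdorff_quotient) :
    set_system hausdorff_quotient :=
  [set A | exists2 B, W B & forall b, B b -> A (y * class_of b)%g].

HB.instance Definition _ := hasNbhs.Build hausdorff_quotient quotient_nbhs.

Let quotient_nbhs_filter y : ProperFilter (quotient_nbhs y).
Proof.
have WF := zero_nbhs_filter zW; apply: Build_ProperFilter_ex.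
  move=> A [B WB BA]; exists (y * class_of 0)%g; apply: BA.
  exact: (zero_nbhs0 zW).
split.
- by exists setT => //; exact: filterT.
- move=> A A' [B WB BA] [B' WB' BA']; exists (B `&` B'); first exact: filterI.
  by move=> b [/BA ? /BA'].
- by move=> A A' AA' [B WB BA]; exists B => // b /BA/AA'.
Qed.

Let quotient_nbhs_singleton y A : quotient_nbhs y A -> A y.
Proof.
move=> [B WB BA]; rewrite -[y]mulg1; apply: BA; exact: (zero_nbhs0 zW).
Qed.

Let quotient_nbhs_nbhs y A : quotient_nbhs y A ->
  quotient_nbhs y (quotient_nbhs^~ A).
Proof.
move=> [B WB BA]; have [B' [WB' _ B'B]] := zero_nbhs_half zW WB.
exists B' => // b Bb; exists B' => // b' Bb'.
by rewrite -mulgA -class_ofD; exact/BA/B'B.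
Qed.

HB.instance Definition _ := Nbhs_isNbhsTopological.Build hausdorff_quotient
  quotient_nbhs_filter quotient_nbhs_singleton quotient_nbhs_nbhs.

Let quotient_mulC (x y : hausdorff_quotient) : (x * y)%g = (y * x)%g.
Proof. exact: qmulC. Qed.

Let quotient_mul_continuous :
  continuous (fun z : hausdorff_quotient * hausdorff_quotient => (z.1 * z.2)%g).
Proof.
move=> [x y] A [B WB BA]; have [B' [WB' _ B'B]] := zero_nbhs_half zW WB.
pose C z := [set (z * class_of b)%g | b in B'] : set hausdorff_quotient.
exists (C x, C y); first by split; exists B' => // b Bb; exists b.
move=> [_ _] /= [[b Bb <-] [b' Bb' <-]].
have -> : (x * class_of b * (y * class_of b') = x * y * class_of (b + b'))%g.
  rewrite class_ofD -!mulgA; congr (x * _)%g; rewrite !mulgA; congr (_ * _)%g.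
  exact: quotient_mulC.
exact/BA/B'B.
Qed.

Let quotient_inv_continuous :
  continuous (fun y : hausdorff_quotient => (y^-1)%g).
Proof.
move=> y A [B WB BA]; have [B' [WB' symB B'B]] := zero_nbhs_half zW WB.
exists B' => // b Bb /=; rewrite invgM quotient_mulC.
have -> : ((class_of b)^-1 = class_of (- b))%g.
  by apply: (mulIg (class_of b)); rewrite mulVg -class_ofD addNr.
apply: BA; rewrite -[- b]addr0.
by apply: B'B; [exact: symB|exact: (zero_nbhs0 zW)].
Qed.

Let quotient_hausdorff : hausdorff_space hausdorff_quotient.
Proof.
move=> x y; rewrite -(repK x) -(repK y) => clxy; apply/class_ofP => A WA.
have [A1 [WA1 symA1 A1A]] := zero_nbhs_half zW WA.
have [A2 [WA2 symA2 A2A1]] := zero_nbhs_half zW WA1.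
pose C z := [set (z * class_of b)%g | b in A2] : set hausdorff_quotient.
have C_nbhs z : nbhs z (C z) by exists A2 => // b Bb; exists b.
have [_ [[b Bb <-] [b' Bb']]] := clxy _ _ (C_nbhs _) (C_nbhs _).
rewrite -!class_ofD => /class_ofP Hxy.
rewrite (_ : _ - _ = (b' - b) - (rep y + b' - (rep x + b))); last first.
  rewrite opprB opprD [rep x + b + _]addrACA [RHS]addrC -addrA.
  by rewrite -(opprB b' b) addNr addr0.
apply: A1A; last exact: (symA1 _ (Hxy _ WA1)).
by apply: A2A1 => //; exact: symA2.
Qed.

HB.instance Definition _ := PreTopologicalGroup_isTopologicalGroup.Build
  hausdorff_quotient quotient_mul_continuous quotient_inv_continuous
  quotient_hausdorff.

Lemma class_of_eq x y : class_of x = class_of y -> forall A, W A -> A (x - y).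
Proof. by move=> /class_ofP. Qed.

Lemma nbhs_class_of x A : nbhs (class_of x) A ->
  exists2 B, W B & forall b, B b -> A (class_of (x + b)).
Proof. by move=> [B WB BA]; exists B => // b /BA; rewrite class_ofD. Qed.

End HausdorffQuotient.

Local Close Scope ring_scope.
Local Open Scope group_scope.

(** * A noncomplete extension of a group without compact exponent *)

Section AdditiveCopy.
Variables (X : topologicalGroupType) (abelianX : forall x y : X, x * y = y * x).

(** The type mentions the proof of commutativity, from which its additive
    structure is inferred. *)
Definition additive_copy : Type := let _ := abelianX in X.

HB.instance Definition _ := Choice.on additive_copy.

HB.instance Definition _ := GRing.isZmodule.Build additive_copy
  (@mulgA X) abelianX (@mul1g X) (@mulVg X).

Lemma additive_copy_natmul (x : additive_copy) n : (x *+ n)%R = (x : X) ^+ n.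
Proof. by elim: n => // n IH; rewrite mulrS IH expgS. Qed.

Let N : set_system additive_copy := nbhs (1 : X).

Lemma zero_nbhs_additive_copy : zero_nbhs N.
Proof.
split; first exact: (nbhs_filter (1 : X)).
- by move=> A NA; exact: (nbhs_singleton NA).
- move=> A NA.
  have : nbhs ((1, 1) : X * X) [set z | A (z.1 * z.2)].
    by apply: mulg_continuous; rewrite mulg1.
  move=> [[P Q] /= [P1 Q1] PQA].
  have inv1 (B : set X) : nbhs (1 : X) B -> nbhs (1 : X) [set x | B x^-1].
    by move=> B1; apply: invg_continuous; rewrite invg1.
  exists (P `&` Q `&` [set x | (P `&` Q) x^-1]); split.
  + have NF : Filter (nbhs (1 : X)) := nbhs_filter (1 : X).
    by apply: filterI; [exact: filterI|exact/inv1/filterI].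
  + by move=> x [Px Qx]; split; [exact: Qx|rewrite /= invgK].
  + by move=> x y [[Px _] _] [[_ Qy] _]; exact: (PQA (x, y)).
Qed.

Lemma additive_copy_separated (u : additive_copy) :
  (forall A, N A -> A u) -> u = 0%R.
Proof.
move=> Nu; apply: (@group_hausdorff X) => A B uA uB.
exists u; split; first exact: nbhs_singleton.
exact: Nu.
Qed.

End AdditiveCopy.

Section AbelianTopologicalGroup.
Variables (X : topologicalGroupType) (abelianX : forall x y : X, x * y = y * x).

Lemma nbhs1_div (A : set X) : nbhs (1 : X) A ->
  exists2 B, nbhs (1 : X) B & forall x y, B x -> B y -> A (x * y^-1).
Proof.
move=> /(zero_nbhs_half (zero_nbhs_additive_copy abelianX))[B [NB symB BA]].
by exists B => // x y Bx By; apply: BA => //; exact: symB.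
Qed.

Lemma nbhs_translate (y : X) (A : set X) :
  nbhs (1 : X) A -> nbhs y [set z | A (z * y^-1)].
Proof.
move=> A1; have : nbhs (y, y^-1) [set z : X * X | A (z.1 * z.2)].
  by apply: mulg_continuous; rewrite mulgV.
move=> [[P Q] /= [Py Qy] PQA]; apply: filterS Py => z Pz.
by apply: (PQA (z, y^-1)); split=> //=; exact: nbhs_singleton.
Qed.

(** Every ultrafilter on the closure of [nX] contains a translate of each
    neighbourhood of the identity, so it is Cauchy and converges. *)
Lemma compact_exponent_of_cover n : complete_group X -> (0 < n)%N ->
  (forall A, nbhs (1 : X) A -> exists E : seq X, forall x : X,
    exists2 e, e \in E & A (x ^+ n * e^-1)) -> compact_exponent X n.
Proof.
move=> completeX n0 cover; split=> //; rewrite compact_ultra => F FU FK.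
have [x Fx] : exists x : two_sided X, F --> x.
  apply: completeX.
  move=> R [A A1 AR].
  have [B B1 BA] := nbhs1_div A1; have [C C1 CB] := nbhs1_div B1.
  have [E EC] := cover C C1.
  have [e eE Fe] : exists2 e, e \in E & F [set y | B (y * e^-1)].
    apply: ultra_seq_cover; apply: filterS FK => y Ky.
    have [_ [[x _ <-]] /= Cyx] := Ky _ (nbhs_translate y C1).
    have [e eE Cxe] := EC x; exists e => //=.
    have := CB _ _ Cxe Cyx; rewrite invgM invgK [_ * e^-1]abelianX.
    by rewrite [y * _]abelianX mulgA [x ^+ n / e]abelianX mulgK.
  exists ([set y | B (y * e^-1)], [set y | B (y * e^-1)]) => //.
  move=> [y z] /= [By Bz].
  apply: AR => /=; have := BA _ _ Bz By.
  rewrite invgM invgK mulgA mulgVK => Azy; split=> //.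
  by rewrite abelianX.
exists x; split=> //; apply: closed_closure => B Bx.
have [y [By Ky]] := filter_ex (filterI (Fx _ Bx) FK).
by exists y.
Qed.

(** When [X] has no compact exponent, no power of [y] lies in the image of
    [f]. *)
Theorem ex_noncomplete_extension : complete_group X ->
  exists (Y : topologicalGroupType) (f : {multiplicative X -> Y}) (y : Y),
    [/\ continuous f, injective f, closure (range f) y &
      forall n, (0 < n)%N -> range f (y ^+ n) -> compact_exponent X n].
Proof.
move=> completeX; pose G := additive_copy abelianX.
have [W [zW WN Wy sepW]] := ex_extension (zero_nbhs_additive_copy abelianX)
  (@additive_copy_separated _ abelianX).
pose Y : topologicalGroupType := hausdorff_quotient zW.
pose cl : (G * int)%type -> Y := class_of zW.
have clD (a b : (G * int)%type) : cl (a + b)%R = cl a * cl b.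
  exact: class_ofD.
pose f (x : X) : Y := cl ((x : G), 0%R).
have fM : {morph f : x x' / x * x'}.
  by move=> x x'; rewrite [RHS](esym (clD _ _)); congr cl.
pose f' : {multiplicative X -> Y} :=
  HB.pack f (isMultiplicative.Build X Y f fM).
have clX a n : cl a ^+ n = cl (a *+ n)%R.
  elim: n => [|n IH]; last by rewrite expgS IH mulrS clD.
  apply: (mulgI (cl 0%R)); rewrite [LHS]mulg1 -[LHS]/(cl 0%R) -{1}[0%R]addr0.
  exact: clD.
exists Y, f', (cl (0, 1)%R); split.
- move=> x A /nbhs_class_of[B WB BA].
  apply: filterS (nbhs_translate x (WN _ WB)) => z /BA.
  congr (A (cl _)); congr pair.
  by rewrite addrC; exact: (subrK (x : G)).
- move=> x x' /(class_of_eq (zW := zW)) Wxx'.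
  by have [/(_ erefl) + _] := sepW _ Wxx'; exact: subr0_eq.
- move=> A /nbhs_class_of[B WB BA].
  have [u Bu] := Wy _ WB; exists (f u); split; first by exists u.
  have := BA _ Bu; congr (A (cl _)); congr pair.
  exact: add0r.
- move=> n n0 [x _]; rewrite clX => fx.
  have [_ bdd] := sepW _ (class_of_eq fx).
  have oneX k : ((0, 1) *+ k : (G * int)%type)%R = (0, k%:Z)%R.
    elim: k => // k IH; rewrite mulrS IH; congr pair; first exact: addr0.
  have zE : (((x : G, 0) - (0, 1) *+ n)%R.2 = - Posz n)%R.
    by rewrite oneX; exact: sub0r.
  apply: compact_exponent_of_cover => // A /bdd; rewrite zE.
  move=> /(mul_boundedM (-1)); rewrite mulN1r opprK => -[E EA].
  exists E => u; have [e eE Ae] := EA u; exists e => //.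
Qed.
End AbelianTopologicalGroup.

(** * Images of groups of compact exponent *)

Lemma sgexpS (S : semigroupType) (y : S) n : sgexp y n.+1 = iter n (mul y) y.
Proof. exact: iteropS. Qed.

Lemma sgexp_expg (Y : groupType) (y : Y) n : (0 < n)%N -> sgexp y n = y ^+ n.
Proof.
case: n => // n _; rewrite sgexpS; elim: n => [|n IH]; first by rewrite expg1.
by rewrite iterS IH -expgS.
Qed.

Lemma sgexp_morph (X : groupType) (S : semigroupType)
    (f : {multiplicative X -> S}) (x : X) n :
  (0 < n)%N -> f (x ^+ n) = sgexp (f x) n.
Proof.
case: n => // n _; rewrite sgexpS; elim: n => [|n IH]; first by rewrite expg1.
by rewrite iterS -IH -gmulfM -expgS.
Qed.

(** The image of the identity is an idempotent that acts as an identity on the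
    closure of the image, so powers of the points of this closure depend
    continuously on them and remain in the compact image of the powers. *)
Lemma compact_exponent_closure (X : topologicalGroupType) (n : nat) :
  compact_exponent X n ->
  forall (Y : powertopologicalSemigroupType) (f : {multiplicative X -> Y}),
    continuous f -> forall y, closure (range f) y -> range f (sgexp y n).
Proof.
move=> [n0 Kcompact] Y f fcont y clfy.
set K := closure _ in Kcompact; pose e := f 1.
have cont k : (0 < k)%N -> continuous (fun z : Y => e * sgexp z k * e).
  exact: sgexp_continuous.
have fe x k : (0 < k)%N -> e * sgexp (f x) k * e = f (x ^+ k).
  by move=> k0; rewrite -sgexp_morph// -!gmulfM mul1g mulg1.
have eye : e * y * e = y.
  apply: semigroup_hausdorff => A B Ay By.
  have gA : nbhs y [set z | A (e * sgexp z 1 * e)].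
    by apply: (cont 1%N isT); rewrite -[nbhs _]/(nbhs (e * y * e)).
  have [_ [[x _ <-] [/= Ax Bx]]] := clfy _ (filterI gA By).
  exists (f x); split=> //.
  by move: Ax (fe x 1%N isT); rewrite expg1 => + <-.
have ee : e * e = e by rewrite -gmulfM mul1g.
have ey : e * y = y by rewrite -{1}eye !mulgA ee eye.
have ye : y * e = y by rewrite -{1}eye -mulgA ee eye.
have eyk : e * sgexp y n * e = sgexp y n.
  case: n n0 {Kcompact K} => // k _; rewrite sgexpS; elim: k => [|k IH].
    by rewrite ey ye.
  by rewrite iterS -[in RHS]IH !mulgA ey ye.
have fKclosed : closed (f @` K).
  apply: compact_closed; first exact: semigroup_hausdorff.
  by apply: continuous_compact => //; exact: continuous_subspaceT.
have [x _ <-] : (f @` K) (sgexp y n); last by exists x.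
apply: fKclosed => A; rewrite -eyk => Ay.
have gA : nbhs y [set z | A (e * sgexp z n * e)] by exact: cont Ay.
have [_ [[x _ <-] /= Ax]] := clfy _ gA.
exists (f (x ^+ n)); split; last by rewrite -fe.
by exists (x ^+ n) => //; apply: subset_closure; exists x.
Qed.

Definition as_powertopological (Y : topologicalGroupType) : Type := Y.

Section GroupIsPowertopological.
Variable Y : topologicalGroupType.

HB.instance Definition _ := Topological.on (as_powertopological Y).
HB.instance Definition _ := Semigroup.on (as_powertopological Y).

Let mul_cvg (f g : Y -> Y) : continuous f -> continuous g ->
  continuous (fun y => f y * g y).
Proof.
move=> fc gc y; apply: (@cvg_comp _ _ _ (fun y => (f y, g y))
  (fun z : Y * Y => z.1 * z.2) _ (nbhs ((f y, g y) : Y * Y))).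
  by apply: cvg_pair; [exact: fc|exact: gc].
exact: (mulg_continuous (f y, g y)).
Qed.

Let sgexp_cont (a b : as_powertopological Y) n : (0 < n)%N ->
  continuous (fun y : as_powertopological Y => a * sgexp y n * b).
Proof.
have cst_cont (c : Y) : continuous (fun _ : Y => c) by move=> ?; exact: cvg_cst.
have id_cont : continuous (@id Y) by move=> ?; exact: cvg_id.
case: n => // n _.
have powcont : continuous (fun y : Y => iter n (mul y) y).
  elim: n => [|n IH]; first exact: id_cont.
  exact: (mul_cvg id_cont IH).
under eq_fun do rewrite sgexpS.
exact: (mul_cvg (mul_cvg (cst_cont a) powcont) (cst_cont b)).
Qed.

HB.instance Definition _ := PreTopologicalSemigroup_isPowertopological.Build
  (as_powertopological Y) sgexp_cont (@group_hausdorff Y).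

End GroupIsPowertopological.

Theorem theorem1p1 (X : topologicalGroupType)
    (abelianX : forall x y : X, x * y = y * x)
    (completeX : complete_group X) :
  [<-> has_compact_exponent X;
       forall (Y : topologicalGroupType) (f : {multiplicative X -> Y}),
         continuous f -> injective f ->
         forall y : Y, closure (range f) y ->
           exists2 k : nat, (0 < k)%N & range f (y ^+ k);
       forall (Y : powertopologicalSemigroupType) (f : {multiplicative X -> Y}),
         continuous f ->
         forall y : Y, closure (range f) y ->
           exists2 k : nat, (0 < k)%N & range f (sgexp y k)]
  /\
  forall n : nat, (0 < n)%N ->
  [<-> compact_exponent X n;
       forall (Y : topologicalGroupType) (f : {multiplicative X -> Y}),
         continuous f -> injective f ->
         forall y : Y, closure (range f) y -> range f (y ^+ n);
       forall (Y : powertopologicalSemigroupType) (f : {multiplicative X -> Y}),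
         continuous f ->
         forall y : Y, closure (range f) y -> range f (sgexp y n)].
Proof.
have [Y [f [y [fcont finj clfy fy]]]] :=
  ex_noncomplete_extension abelianX completeX.
split.
  have to3 : has_compact_exponent X ->
      forall (Z : powertopologicalSemigroupType) (g : {multiplicative X -> Z}),
      continuous g -> forall z : Z,
      closure (range g) z -> exists2 k : nat, (0 < k)%N & range g (sgexp z k).
    move=> [n nX] Z g gcont z clz; exists n; first by have [] := nX.
    exact: (compact_exponent_closure nX gcont clz).
  tfae.
  - move=> /to3 H Z g gcont _ z clz.
    have [k k0] := H (as_powertopological Z) g gcont z clz.
    by rewrite sgexp_expg//; exists k.
  - move=> /(_ Y f fcont finj y clfy)[n n0 /(fy n n0) nX].
    by apply: to3; exists n.
  - move=> H; have [k k0] := H (as_powertopological Y) f fcont y clfy.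
    by rewrite sgexp_expg// => /(fy k k0); exists k.
move=> n n0; tfae.
- move=> nX Z g gcont _ z clz; rewrite -sgexp_expg//.
  have := compact_exponent_closure nX (Y := as_powertopological Z).
  by move=> /(_ g gcont z clz).
- move=> /(_ Y f fcont finj y clfy) /(fy n n0) nX.
  exact: (compact_exponent_closure nX).
- move=> H; apply: (fy n n0); rewrite -sgexp_expg//.
  exact: (H (as_powertopological Y) f fcont y clfy).
Qed.
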